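(* (1) For $\mathcal{R} = \mathcal{R}_{\rm BL} \cup \mathcal{R}_{\rm NW} \cup \mathcal{R}_{\rm NE}$, $m_{\mathcal{R}}(k) \leq 5k-2$ for all $k$. (2) For $\mathcal{R} = \mathcal{R}_{\rm HS} \cup \mathcal{R}_{\rm VS} \cup \mathcal{R}_{\rm NW} \cup \mathcal{R}_{\rm NE} \cup \mathcal{R}_{\rm SW} \cup \mathcal{R}_{\rm SE}$, $m_{\mathcal{R}}(k) \leq 10k-1$ for all $k$. (3) For $\mathcal{R} = \mathcal{R}_{\rm HS} \cup \mathcal{R}_{\rm VS} \cup \mathcal{R}_{\rm DS} \cup \mathcal{R}_{\rm NW} \cup \mathcal{R}_{\rm SE}$, $m_{\mathcal{R}}(k) \leq \lceil 4k\ln k + k\ln 3 \rceil + 4k$ for all $k$.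
   Context: Range families (all parameters range over $\mathbb{R}$): north-west quadrants $\mathcal{R}_{\rm NW} = \{\{x \leq a, y \geq b\}\}$, north-east $\mathcal{R}_{\rm NE} = \{\{x \geq a, y \geq b\}\}$, south-west $\mathcal{R}_{\rm SW} = \{\{x \leq a, y \leq b\}\}$, south-east $\mathcal{R}_{\rm SE} = \{\{x \geq a, y \leq b\}\}$; horizontal strips $\mathcal{R}_{\rm HS} = \{\{b_1 \leq y \leq b_2\}\}$; vertical strips $\mathcal{R}_{\rm VS} = \{\{a_1 \leq x \leq a_2\}\}$; diagonal strips $\mathcal{R}_{\rm DS} = \{\{a \leq x+y \leq b\}\}$; bottomless rectangles $\mathcal{R}_{\rm BL} = \{\{a_1 \leq x \leq a_2, y \leq b\}\}$. For finite $V \subset \mathbb{R}^2$, $\mathcal{H}(V,\mathcal{R},m)$ is the hypergraph on $V$ whose hyperedges are the sets $V \cap R$, $R \in \mathcal{R}$, of size exactly $m$. A $k$-coloring is polychromatic if every hyperedge contains all $k$ colors. Point sets are in general position (pairwise distinct $x$-coordinates, $y$-coordinates and values $x+y$). $m_{\mathcal{R}}(k)$ is the smallest $m$ such that for every finite $V$ in general position $\mathcal{H}(V,\mathcal{R},m)$ admits a polychromatic $k$-coloring. *)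

(* Defs.v *)
From Stdlib Require Import Reals List ZArith.
Import ListNotations.
Open Scope R_scope.

Definition point := (R * R)%type.
Definition range := point -> Prop.
Definition family := range -> Prop.

Definition R_NW : family := fun r => exists a b : R,
  forall p : point, r p <-> (fst p <= a /\ snd p >= b).
Definition R_NE : family := fun r => exists a b : R,
  forall p : point, r p <-> (fst p >= a /\ snd p >= b).
Definition R_SW : family := fun r => exists a b : R,
  forall p : point, r p <-> (fst p <= a /\ snd p <= b).
Definition R_SE : family := fun r => exists a b : R,
  forall p : point, r p <-> (fst p >= a /\ snd p <= b).
Definition R_HS : family := fun r => exists b1 b2 : R,
  forall p : point, r p <-> (b1 <= snd p /\ snd p <= b2).
Definition R_VS : family := fun r => exists a1 a2 : R,
  forall p : point, r p <-> (a1 <= fst p /\ fst p <= a2).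
Definition R_DS : family := fun r => exists a b : R,
  forall p : point, r p <-> (a <= fst p + snd p /\ fst p + snd p <= b).
Definition R_BL : family := fun r => exists a1 a2 b : R,
  forall p : point, r p <-> (a1 <= fst p /\ fst p <= a2 /\ snd p <= b).

Definition funion (F G : family) : family := fun r => F r \/ G r.

Definition general_position (V : list point) : Prop :=
  NoDup V /\ NoDup (map fst V) /\ NoDup (map snd V) /\
  NoDup (map (fun p => fst p + snd p) V).

Definition hyperedge (V : list point) (F : family) (m : nat) (E : list point) : Prop :=
  NoDup E /\ length E = m /\
  exists r, F r /\ forall p, In p E <-> (In p V /\ r p).

Definition polychromatic (V : list point) (F : family) (m k : nat)
    (col : point -> nat) : Prop :=
  (forall p, In p V -> (col p < k)%nat) /\
  forall E, hyperedge V F m E ->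
    forall c, (c < k)%nat -> exists p, In p E /\ col p = c.

Definition good (F : family) (k m : nat) : Prop :=
  forall V, general_position V -> exists col, polychromatic V F m k col.

(* m_F(k) <= M  <->  the least m with (good F k m) exists and is <= M
   <->  some m <= M has (good F k m). *)
Definition mR_le (F : family) (k M : nat) : Prop :=
  exists m, (m <= M)%nat /\ good F k m.

(* Ceiling of a real number, as an integer: ceilZ x = -(floor(-x)). *)
Definition ceilZ (x : R) : Z := (1 - up (- x))%Z.

(* Main.v *)
(* A quadrant family is handled by sweeping: points are inserted by decreasing height, the window
   consists of the [m] leftmost points seen so far, and it always contains exactly one point of each
   color.  When a colored point is pushed out of the window, the leftmost uncolored point of the
   window takes over its color.  Every colored point then guards [m - k] points that are never
   colored and lie between consecutive points of its color; hence this partial coloring removes at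
   most [k] points from a bottomless rectangle or a quadrant sharing the vertical direction, and at
   most [2 k] from any of the other ranges, as long as enough points must remain.  What is left
   over is colored for bottomless rectangles with [3 k - 2] (keeping equal colors [k - 1] apart), or
   for strips: cut each of the orders into blocks and split the blocks by iterated rounding.  For
   two orders the rounding is exact, as for edge colorings of bipartite graphs; for three orders it
   is off by less than 3 (Beck-Fiala), so blocks of linear size [4 k - 3] suffice, which is below
   the bound coming from the Local Lemma. *)
Require Import Defs.
From Stdlib Require Import Reals ZArith.
From Stdlib Require Import List Permutation Sorted Bool Classical Lia Lra.
Import ListNotations.
Open Scope R_scope.

(** Why guards bound the loss: a range that loses more than [k] (or [2 * k]) of its points to the
    partial coloring contains two (or three) points of one color by pigeonhole, and then the [m - k]
    guards of one of them are trapped in the range. The costs add up: [5 * k - 2] is [3 * k - 2]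
    plus twice [k], and [10 * k - 1] is [2 * k - 1] plus four times [2 * k].

    Guards lie between points of their color in both coordinates at once: along increasing [x] and
    [y] for NW and SE, along increasing [x] and decreasing [y] for NE and SW. A diagonal strip
    contains the boxes spanned by its points in the first direction only, which is why it goes
    together with NW and SE.

    The delicate point is that guards are fixed during the sweep, while later points may take over a
    guard or create an equal color further left. The induction therefore also controls the height of
    every point that might still be colored. *)

(** * Finite point sets and sorting along a coordinate *)

Definition inj_on (f : point -> R) (V : list point) : Prop :=
  forall p q, In p V -> In q V -> f p = f q -> p = q.

Lemma point_eq_dec (p q : point) : {p = q} + {p <> q}.
Proof. decide equality; apply Req_EM_T. Qed.

Definition mem (X : list point) (p : point) : bool :=
  if in_dec point_eq_dec p X then true else false.

Definition minus (V X : list point) : list point :=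
  filter (fun p => negb (mem X p)) V.

(** Hyperedges have a fixed size, but the number of points that a range keeps after a partial
    coloring varies; a lower bound on the size is what survives from one stage to the next. *)
Definition rich (V : list point) (r : range) (n : nat) : Prop :=
  exists E, NoDup E /\ incl E V /\ (forall p, In p E -> r p) /\ (n <= length E)%nat.

Lemma mem_spec X p : mem X p = true <-> In p X.
Proof. unfold mem; destruct (in_dec point_eq_dec p X); split; intros; auto; discriminate. Qed.

Lemma in_minus V X p : In p (minus V X) <-> In p V /\ ~ In p X.
Proof.
  unfold minus; rewrite filter_In, negb_true_iff, <- not_true_iff_false, mem_spec; tauto.
Qed.

Lemma NoDup_minus V X : NoDup V -> NoDup (minus V X).
Proof. apply NoDup_filter. Qed.

Lemma length_minus V X :
  (length (filter (mem X) V) + length (minus V X) = length V)%nat.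
Proof. apply filter_length. Qed.

Lemma inj_on_incl f V V' : incl V' V -> inj_on f V -> inj_on f V'.
Proof. intros H I p q Hp Hq; apply I; auto. Qed.

Lemma inj_on_opp f V : inj_on f V -> inj_on (fun p => - f p) V.
Proof. intros I p q Hp Hq H; apply I; auto; lra. Qed.

Lemma inj_on_map f V : NoDup (map f V) -> inj_on f V.
Proof.
  induction V as [|v V IH]; simpl; intros N p q Hp Hq E; [easy|].
  inversion N as [|? ? N1 N2]; subst.
  destruct Hp as [<-|Hp], Hq as [<-|Hq]; auto.
  - exfalso; apply N1; rewrite E; now apply in_map.
  - exfalso; apply N1; rewrite <- E; now apply in_map.
  - now apply IH.
Qed.

Lemma rich_le V r n n' : (n' <= n)%nat -> rich V r n -> rich V r n'.
Proof. intros H (E & ? & ? & ? & ?); exists E; repeat split; auto; lia. Qed.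

Lemma sorted_exists (f : point -> R) V : NoDup V -> inj_on f V ->
  exists L, Permutation V L /\ StronglySorted (fun p q => f p < f q) L.
Proof.
  induction V as [|v V IH]; intros N I.
  - exists []; split; constructor.
  - inversion N as [|? ? N1 N2]; subst.
    destruct (IH N2) as (L & PL & SL).
    { eapply inj_on_incl; [|exact I]; intros ? ?; now right. }
    assert (Hv : forall p, In p L -> f p <> f v).
    { intros p Hp E. apply N1.
      assert (In p V) by (eapply Permutation_in; [symmetry; exact PL|exact Hp]).
      rewrite <- (I p v); simpl; auto. }
    cut (exists L', Permutation (v :: L) L' /\ StronglySorted (fun p q => f p < f q) L').
    { intros (L' & PL' & SL'); exists L'; split; auto.
      eapply perm_trans; [apply perm_skip; exact PL|exact PL']. }
    clear PL N I N1 N2 IH V.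
    induction SL as [|p L SL IH FL].
    + exists [v]; split; repeat constructor.
    + destruct (Rlt_dec (f v) (f p)) as [h|h].
      * exists (v :: p :: L); split; auto. repeat constructor; auto.
        eapply Forall_impl; [|exact FL]; simpl; intros; lra.
      * destruct IH as (L' & PL' & SL').
        { intros q Hq; apply Hv; now right. }
        exists (p :: L'); split.
        { eapply perm_trans; [apply perm_swap|]; now apply perm_skip. }
        constructor; auto. apply Forall_forall; intros q Hq.
        apply (Permutation_in q (Permutation_sym PL')) in Hq.
        destruct Hq as [<-|Hq].
        { specialize (Hv p (or_introl eq_refl)); lra. }
        { rewrite Forall_forall in FL; auto. }
Qed.

Lemma split_low (f : point -> R) V n : NoDup V -> inj_on f V -> (n <= length V)%nat ->
  exists A B, Permutation V (A ++ B) /\ length A = n /\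
    forall a b, In a A -> In b B -> f a < f b.
Proof.
  intros N I Hn. destruct (sorted_exists f V N I) as (L & PL & SL).
  exists (firstn n L), (skipn n L). rewrite firstn_skipn. split; [exact PL|]. split.
  - apply firstn_length_le. now rewrite <- (Permutation_length PL).
  - clear - SL. revert n; induction SL as [|p L SL IH FL]; intros [|n] a b Ha Hb; simpl in *; try easy.
    destruct Ha as [<-|Ha]; [|eapply IH; eauto].
    rewrite Forall_forall in FL; apply FL.
    rewrite <- (firstn_skipn n L); apply in_or_app; now right.
Qed.

Lemma min_exists (f : point -> R) V : NoDup V -> inj_on f V -> V <> [] ->
  exists q L, Permutation V (q :: L) /\ forall l, In l L -> f q < f l.
Proof.
  intros N I H. destruct (sorted_exists f V N I) as (L & PL & SL).
  destruct L as [|q L]; [now apply Permutation_sym, Permutation_nil in PL|].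
  exists q, L; split; auto. inversion SL as [|? ? ? F]; subst.
  now rewrite Forall_forall in F.
Qed.

(** * Hitting all quadrants of one direction *)

(* [late] describes the uncolored points that may still be given the color of [p]. *)
Definition guarded (f g : point -> R) (V X : list point) (col : point -> nat)
    (n : nat) (late : range) (p : point) : Prop :=
  exists U, NoDup U /\ (n <= length U)%nat /\ forall u, In u U ->
    In u V /\ ~ In u X /\ f p < f u /\
    (forall q, In q X -> col q = col p -> f q < f p -> g q < g u) /\
    (forall q, In q X -> col q = col p -> f p < f q -> f u < f q /\ g u < g q) /\
    (forall w, late w -> f w < f p -> g w < g u).

Definition quadrant (f g : point -> R) (a b : R) : range := fun p => f p <= a /\ b <= g p.

(** [P] is swept, [W] is the window, [X] is colored. The next point to be colored is an uncolored
    window point; [sw_new] and the [late] clause in [sw_guard] bound its height in advance, against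
    the colored points and against their guards. *)
Record sweep_state (f g : point -> R) (m k : nat) (P W X : list point)
    (col : point -> nat) : Prop := {
  sw_X : incl X P;
  sw_col : forall p, In p X -> (col p < k)%nat;
  sw_nodup : NoDup W;
  sw_len : length W = m;
  sw_W : incl W P;
  sw_low : forall w z, In w W -> In z P -> ~ In z W -> f w < f z;
  sw_all : forall c, (c < k)%nat -> exists p, In p W /\ In p X /\ col p = c;
  sw_inj : forall p q, In p W -> In q W -> In p X -> In q X -> col p = col q -> p = q;
  sw_new : forall p w, In p X -> In w W -> ~ In w X -> f w < f p -> g w < g p;
  sw_guard : forall p, In p X ->
    guarded f g P X col (m - k) (fun w => In w W /\ ~ In w X) p;
  sw_hit : forall a b, rich P (quadrant f g a b) m -> forall c, (c < k)%nat ->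
    exists p, In p X /\ quadrant f g a b p /\ col p = c
}.

Lemma bijective_coloring (A : list point) : NoDup A -> exists col : point -> nat,
  (forall p, In p A -> (col p < length A)%nat) /\
  (forall c, (c < length A)%nat -> exists p, In p A /\ col p = c) /\
  (forall p q, In p A -> In q A -> col p = col q -> p = q).
Proof.
  induction 1 as [|v A N1 N2 (col & C1 & C2 & C3)].
  - exists (fun _ => 0%nat); simpl; repeat split; intros; try easy; lia.
  - exists (fun p => if point_eq_dec p v then length A else col p).
    simpl; repeat split.
    + intros p Hp. destruct (point_eq_dec p v); [lia|].
      destruct Hp as [->|Hp]; [easy|]. specialize (C1 p Hp); lia.
    + intros c Hc. destruct (Nat.eq_dec c (length A)) as [->|h].
      * exists v; split; auto. now destruct (point_eq_dec v v).
      * destruct (C2 c) as (p & Hp & E); [lia|]. exists p; split; auto.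
        destruct (point_eq_dec p v) as [->|]; easy.
    + intros p q Hp Hq.
      destruct (point_eq_dec p v) as [hp|hp], (point_eq_dec q v) as [hq|hq]; intros E.
      * congruence.
      * destruct Hq as [|Hq]; [congruence|]. specialize (C1 q Hq); lia.
      * destruct Hp as [|Hp]; [congruence|]. specialize (C1 p Hp); lia.
      * destruct Hp, Hq; try congruence. auto.
Qed.

(** If a window point [w] were beyond [a], the points of the quadrant would all be left of [w],
    hence in the window, which would then hold [m + 1] points. *)
Lemma window_inside (f g : point -> R) m P W a b :
  NoDup W -> length W = m -> (forall w z, In w W -> In z P -> ~ In z W -> f w < f z) ->
  rich P (quadrant f g a b) m -> forall w, In w W -> f w <= a.
Proof.
  intros NW LW low (E & NE & IE & RE & LE) w Hw.
  destruct (Rle_dec (f w) a) as [|h]; auto. exfalso.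
  assert (N : ~ In w E) by (intros H; apply RE in H; destruct H; lra).
  assert (I : incl (w :: E) W).
  { intros e [<-|He]; auto. destruct (in_dec point_eq_dec e W) as [|n]; auto.
    specialize (low w e Hw (IE e He) n). destruct (RE e He); lra. }
  apply NoDup_incl_length in I; [simpl in I; lia|]. now constructor.
Qed.

(** The [k] leftmost points receive distinct colors and share the other [m - k] points as guards.
    All conditions on equal colors or on late points to the left are then void. *)
Lemma sweep_start f g m k P : NoDup P -> inj_on f P -> length P = m -> (k <= m)%nat ->
  exists W X col, sweep_state f g m k P W X col.
Proof.
  intros N I L K.
  destruct (split_low f P k N I) as (A & B & PP & LA & AB); [lia|].
  assert (NAB : NoDup (A ++ B)) by (eapply Permutation_NoDup; eauto).
  assert (NA : NoDup A) by (eapply NoDup_app_remove_r; eauto).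
  assert (NB : NoDup B) by (eapply NoDup_app_remove_l; eauto).
  assert (inP : forall p, In p P <-> In p A \/ In p B).
  { intros p. rewrite <- in_app_iff. split; apply Permutation_in; auto. now symmetry. }
  assert (disj : forall p, In p A -> In p B -> False).
  { intros p H1 H2. specialize (AB p p H1 H2); lra. }
  assert (LB : length B = (m - k)%nat).
  { apply Permutation_length in PP. rewrite length_app in PP; lia. }
  destruct (bijective_coloring A NA) as (col & C1 & C2 & C3). rewrite LA in *.
  exists P, A, col. constructor; auto.
  - intros p Hp; apply inP; auto.
  - now intros p Hp.
  - intros w z _ H1 H2; easy.
  - intros c Hc. destruct (C2 c Hc) as (p & Hp & E). exists p; repeat split; auto.
    apply inP; auto.
  - intros p w Hp Hw HwA h. apply inP in Hw. destruct Hw as [|Hw]; [easy|].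
    specialize (AB p w Hp Hw); lra.
  - intros p Hp. exists B; repeat split; auto; try lia.
    + apply inP; auto.
    + eauto.
    + intros q Hq E h. apply C3 in E; auto. subst; lra.
    + apply C3 in H1; auto. subst; lra.
    + apply C3 in H1; auto. subst; lra.
    + intros w (Hw & HwA) h. apply inP in Hw. destruct Hw as [|Hw]; [easy|].
      specialize (AB p w Hp Hw); lra.
  - intros a b (E & NE & IE & RE & LE) c Hc.
    destruct (C2 c Hc) as (p & Hp & Ec). exists p.
    assert (H : incl P E) by (apply NoDup_length_incl; auto; lia).
    split; [auto|split; [|auto]]. apply RE, H, inP; auto.
Qed.

Lemma sweep_window (f : point -> R) m P v r W W' :
  NoDup (v :: W) -> length W = m -> incl W P ->
  (forall w z, In w W -> In z P -> ~ In z W -> f w < f z) ->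
  Permutation (v :: W) (r :: W') -> (forall w, In w W' -> f w < f r) ->
  NoDup (r :: W') /\ length W' = m /\ incl W' (v :: P) /\
  (forall w z, In w W' -> In z (v :: P) -> ~ In z W' -> f w < f z) /\
  (forall p, p = v \/ In p W <-> p = r \/ In p W').
Proof.
  intros N L I low PW Hr.
  assert (eqv : forall p, p = v \/ In p W <-> p = r \/ In p W').
  { intros p. split; intros H.
    - destruct (Permutation_in p PW); simpl; intuition.
    - destruct (Permutation_in p (Permutation_sym PW)); simpl; intuition. }
  repeat split; try apply eqv.
  - eapply Permutation_NoDup; eauto.
  - apply Permutation_length in PW. simpl in PW; lia.
  - intros p Hp. destruct (proj2 (eqv p)) as [->|]; simpl; auto.
  - intros w z Hw Hz Nz.
    destruct (point_eq_dec z r) as [->|h]; auto.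
    assert (HzW : ~ (z = v \/ In z W)) by (rewrite eqv; tauto).
    destruct Hz as [<-|Hz]; [tauto|].
    destruct (proj2 (eqv w)) as [->|HwW]; auto.
    destruct (proj2 (eqv r)) as [->|HrW]; auto.
    + apply Hr in Hw; lra.
    + apply Rlt_trans with (f r); auto.
Qed.

(** The coloring changes only if the point [r] that leaves the window is colored. The newly colored
    point [q] can spoil only guard sets of points to its left; these points, and [q] itself, all get
    the remaining uncolored window points [L'] as new guards. *)
Lemma sweep_step f g m k P v W X col :
  NoDup (v :: P) -> inj_on f (v :: P) -> (forall p, In p P -> g v < g p) -> (k <= m)%nat ->
  sweep_state f g m k P W X col ->
  exists W' X' col', sweep_state f g m k (v :: P) W' X' col'.
Proof.
  intros N I low K S. inversion N as [|? ? Nv NP]; subst.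
  destruct S as [sX scol snd slen sW slow sall sinj snew sguard shit].
  assert (NW : NoDup (v :: W)) by (constructor; auto).
  assert (IW : incl (v :: W) (v :: P)) by (intros p [<-|H]; simpl; auto).
  destruct (min_exists (fun p => - f p) (v :: W)) as (r & W' & PW & Hr0); auto; [|easy|].
  { eapply inj_on_incl; [exact IW|now apply inj_on_opp]. }
  assert (Hr : forall w, In w W' -> f w < f r) by (intros w Hw; apply Hr0 in Hw; lra).
  destruct (sweep_window f (length W) P v r W W') as (NrW & lenW' & I' & low' & eqv); auto.
  inversion NrW as [|? ? Nr NW']; subst.
  assert (vX : ~ In v X) by auto.
  assert (W'W : forall p, In p W' -> In p X -> In p W).
  { intros p H1 H2. destruct (proj2 (eqv p)) as [->|]; auto; easy. }
  assert (WW' : forall p, In p W -> p <> r -> In p W').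
  { intros p H1 H2. destruct (proj1 (eqv p)) as [|]; auto; easy. }
  (* The new point [v] is lower than everything swept before, so height bounds on window points only
     have to be checked on the old window. *)
  assert (lowU : forall p u w, In p X -> In u P -> In w W' -> ~ In w X ->
            (In w W -> g w < g u) -> g w < g u).
  { intros p u w Hp Hu Hw HwX H. destruct (proj2 (eqv w)) as [->|]; auto. }
  (* A quadrant containing [v] reaches below all swept points, so with [m] points it contains the
     whole window; a quadrant without [v] was hit before. *)
  assert (hits : forall X' col', (forall p, In p X -> In p X' /\ col' p = col p) ->
            incl X' (v :: P) ->
            (forall c, (c < k)%nat -> exists p, In p W' /\ In p X' /\ col' p = c) ->
            forall a b, rich (v :: P) (quadrant f g a b) (length W) -> forall c, (c < k)%nat ->
            exists p, In p X' /\ quadrant f g a b p /\ col' p = c).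
  { intros X' col' ext iX' all a b HE c Hc.
    destruct (classic (quadrant f g a b v)) as [[Hva Hvb]|Hv].
    - destruct (all c Hc) as (p & H1 & H2 & H3). exists p; repeat split; auto.
      + eapply window_inside; eauto.
      + destruct (iX' p H2) as [<-|Hp]; auto. apply low in Hp; lra.
    - destruct HE as (E & NE & IE & RE & LE).
      destruct (shit a b) with (c := c) as (p & H1 & H2 & H3); auto.
      { exists E; repeat split; auto; try apply RE; auto.
        intros e He. destruct (IE e He) as [<-|]; auto. exfalso; auto. }
      destruct (ext p H1). exists p; repeat split; auto; try apply H2; congruence. }
  destruct (in_dec point_eq_dec r X) as [HrX|HrX].
  2:{
    exists W', X, col.
    assert (all : forall c, (c < k)%nat -> exists p, In p W' /\ In p X /\ col p = c).
    { intros c Hc. destruct (sall c Hc) as (p & H1 & H2 & H3). exists p; repeat split; auto.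
      apply WW'; auto. congruence. }
    constructor; auto.
    - intros p Hp; right; auto.
    - intros p w Hp Hw HwX h. apply (lowU p p); auto.
    - intros p Hp. destruct (sguard p Hp) as (U & NU & LU & HU).
      exists U; split; [auto|split;[auto|]]. intros u Hu.
      destruct (HU u Hu) as (U1 & U2 & U3 & U4 & U5 & U6).
      repeat split; simpl; auto; try (eapply U5; eauto).
      intros w (H1 & H2) h. apply (lowU p u); auto.
    - apply hits; auto. intros p Hp; right; auto. }
  assert (HrW : In r W) by (destruct (proj2 (eqv r)) as [->|]; auto; easy).
  set (L := minus W' X).
  assert (NL : NoDup L) by now apply NoDup_minus.
  (* Window colors are distinct and [r] took one of them away, so at least [m - k + 1] uncolored
     points stay: the leftmost, [q], and [m - k] guards. *)
  assert (cnt : (length (filter (mem X) W') < k)%nat).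
  { assert (H : (length (map col (r :: filter (mem X) W')) <= length (seq 0 k))%nat).
    { apply NoDup_incl_length.
      - apply NoDup_map_NoDup_ForallPairs.
        + intros p q Hp Hq. apply sinj.
          * destruct Hp as [<-|Hp]; auto. apply filter_In in Hp. rewrite mem_spec in Hp. apply W'W; tauto.
          * destruct Hq as [<-|Hp0]; auto. apply filter_In in Hp0. rewrite mem_spec in Hp0. apply W'W; tauto.
          * destruct Hp as [<-|Hp]; auto. apply filter_In in Hp. rewrite mem_spec in Hp; tauto.
          * destruct Hq as [<-|Hp0]; auto. apply filter_In in Hp0. rewrite mem_spec in Hp0; tauto.
        + constructor; [|now apply NoDup_filter]. rewrite filter_In; tauto.
      - intros c Hc. apply in_map_iff in Hc. destruct Hc as (p & <- & Hp).
        apply in_seq. split; [lia|]. apply scol.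
        destruct Hp as [<-|Hp]; auto. apply filter_In in Hp. rewrite mem_spec in Hp; tauto. }
    rewrite length_map, length_seq in H. simpl in H; lia. }
  assert (LL := length_minus W' X). fold L in LL.
  destruct (min_exists f L) as (q & L' & PL & Hq); auto.
  { eapply inj_on_incl; [|exact I]. intros p Hp. apply in_minus in Hp. apply I'; tauto. }
  { intros E. rewrite E in LL; simpl in LL; lia. }
  assert (NqL : NoDup (q :: L')) by (eapply Permutation_NoDup; eauto).
  inversion NqL as [|? ? Nq NL']; subst.
  assert (inL : forall p, p = q \/ In p L' <-> In p W' /\ ~ In p X).
  { intros p. rewrite <- in_minus. fold L. split; intros H.
    - apply (Permutation_in p (Permutation_sym PL)). simpl; intuition.
    - apply (Permutation_in p PL) in H. simpl in H; intuition. }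
  destruct (proj1 (inL q)) as (qW & qX); auto.
  assert (LL' : (length W - k <= length L')%nat).
  { apply Permutation_length in PL. simpl in PL; lia. }
  set (col' := fun p => if point_eq_dec p q then col r else col p).
  assert (cq : col' q = col r) by (unfold col'; now destruct (point_eq_dec q q)).
  assert (cX : forall p, In p X -> col' p = col p).
  { intros p Hp. unfold col'. destruct (point_eq_dec p q) as [->|]; easy. }
  assert (uniqr : forall p, In p W' -> In p X -> col p <> col r).
  { intros p H1 H2 E. apply sinj in E; auto. congruence. }
  (* The colors of the window are pairwise distinct, so points of one color to the right of
     [q] have left the window; the points of [L'] entered after those were colored. *)
  assert (fresh : forall p, In p (q :: X) -> In p W' -> f p <= f q -> forall u, In u L' ->
            In u (v :: P) /\ ~ In u (q :: X) /\ f p < f u /\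
            (forall z, In z (q :: X) -> col' z = col' p -> f z < f p -> g z < g u) /\
            (forall z, In z (q :: X) -> col' z = col' p -> f p < f z -> f u < f z /\ g u < g z) /\
            (forall w, In w W' /\ ~ In w (q :: X) -> f w < f p -> g w < g u)).
  { intros p Hp HpW hpq u Hu.
    destruct (proj1 (inL u)) as (uW & uX); auto.
    assert (hqu := Hq u Hu).
    assert (injp : forall z, In z (q :: X) -> In z W' -> col' z = col' p -> z = p).
    { intros z Hz HzW E.
      destruct (in_dec point_eq_dec p X) as [pX|pX], (in_dec point_eq_dec z X) as [zX|zX].
      - rewrite !cX in E by auto. apply sinj; auto.
      - destruct Hz as [<-|]; [|easy]. rewrite cq, cX in E by auto.
        now destruct (uniqr p).
      - destruct Hp as [<-|]; [|easy]. rewrite cq, cX in E by auto.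
        now destruct (uniqr z).
      - destruct Hp as [<-|]; [|easy]. destruct Hz as [<-|]; easy. }
    assert (iX : incl (q :: X) (v :: P)) by (intros z [<-|Hz]; [auto|right; auto]).
    split; [auto|]. split; [intros [<-|]; easy|]. split; [lra|]. repeat split.
    - intros z Hz E h. destruct (in_dec point_eq_dec z W') as [zW|zW].
      + rewrite (injp z) in h by auto; lra.
      + specialize (low' p z HpW (iX z Hz) zW); lra.
    - destruct (in_dec point_eq_dec z W') as [zW|zW].
      + rewrite (injp z) in H1 by auto; lra.
      + auto.
    - destruct (in_dec point_eq_dec z W') as [zW|zW].
      + rewrite (injp z) in H1 by auto; lra.
      + assert (zX : In z X) by (destruct H as [<-|]; easy).
        apply (lowU z z); auto.
    - intros w (w1 & w2) h. exfalso.
      destruct (proj2 (inL w)) as [->|H].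
      + split; auto. intros H; apply w2; now right.
      + apply w2; now left.
      + apply Hq in H; lra. }
  assert (all : forall c, (c < k)%nat -> exists p, In p W' /\ In p (q :: X) /\ col' p = c).
  { intros c Hc. destruct (Nat.eq_dec c (col r)) as [->|h].
    - exists q; simpl; auto.
    - destruct (sall c Hc) as (p & H1 & H2 & H3). exists p; repeat split; simpl; auto.
      + apply WW'; auto. congruence.
      + now rewrite cX. }
  exists W', (q :: X), col'. constructor; auto.
  - intros p [<-|Hp]; auto. right; auto.
  - intros p [<-|Hp]; [rewrite cq; auto|rewrite cX; auto].
  - intros p z pW zW [<-|pX] [<-|zX] E; auto.
    + rewrite cq, cX in E by auto. now destruct (uniqr z).
    + rewrite cq, cX in E by auto. now destruct (uniqr p).
    + rewrite !cX in E by auto. apply sinj; auto.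
  - intros p w Hp Hw HwX h.
    destruct (proj1 (inL w)) as [H1 H2]; [|].
    { destruct (proj2 (inL w)) as [->|H]; auto. split; auto. intros H; apply HwX; now right. }
    destruct Hp as [<-|Hp].
    + destruct (proj2 (inL w)) as [->|H]; auto; [lra|]. apply Hq in H; lra.
    + apply (lowU p p); auto.
  - intros p Hp.
    destruct (Rlt_dec (f q) (f p)) as [h|h].
    (* To the right of [q] the old guards survive: they lie right of [q], and [q] is lower than they
       are, by the [late] clause of the old state or because [q] is the new lowest point [v]. *)
    + assert (pX : In p X) by (destruct Hp as [<-|]; [lra|easy]).
      destruct (sguard p pX) as (U & NU & LU & HU).
      exists U; split; [auto|split;[auto|]]. intros u Hu.
      destruct (HU u Hu) as (U1 & U2 & U3 & U4 & U5 & U6).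
      split; [now right|]. split; [intros [<-|]; auto; lra|]. split; [auto|]. repeat split.
      * intros z [<-|zX] E hz; [|rewrite !cX in E by auto; auto].
        apply (lowU p u); auto.
      * destruct H as [<-|zX]; [lra|]. rewrite !cX in H0 by auto. eapply U5; eauto.
      * destruct H as [<-|zX]; [lra|]. rewrite !cX in H0 by auto. eapply U5; eauto.
      * intros w (H1 & H2) hw.
        assert (~ In w X) by (intros H; apply H2; now right).
        apply (lowU p u); auto.
    + assert (pW : In p W').
      { destruct (in_dec point_eq_dec p W') as [|n]; auto.
        assert (In p (v :: P)) by (destruct Hp as [<-|Hp]; [auto|right; auto]).
        specialize (low' q p qW H n); lra. }
      exists L'; split; [auto|split;[auto|]]. apply fresh; auto. lra.
  - apply hits; auto.
    + intros p Hp; split; [now right|auto].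
    + intros p [<-|Hp]; auto. right; auto.
Qed.

Lemma sweep_exists f g m k P : NoDup P -> inj_on f P ->
  StronglySorted (fun p q => g p < g q) P -> (k <= m)%nat -> (m <= length P)%nat ->
  exists W X col, sweep_state f g m k P W X col.
Proof.
  induction P as [|v P IH]; intros N I S K L.
  - apply sweep_start; auto. simpl in *; lia.
  - destruct (Nat.eq_dec (length (v :: P)) m) as [E|E]; [apply sweep_start; auto|].
    inversion N as [|? ? N1 N2]; subst. inversion S as [|? ? S' F]; subst.
    assert (I' : inj_on f P) by (eapply inj_on_incl; [|exact I]; intros ? ?; now right).
    simpl in L, E.
    destruct (IH N2 I' S' K) as (W & X & col & H); [lia|].
    eapply sweep_step; eauto. now rewrite Forall_forall in F.
Qed.

Definition hits_all (V X : list point) (r : range) (col : point -> nat) (k : nat) : Prop :=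
  forall c, (c < k)%nat -> exists p, In p X /\ r p /\ col p = c.

Lemma quadrant_coloring f g V m k : NoDup V -> inj_on f V -> inj_on g V -> (k <= m)%nat ->
  exists X col, incl X V /\ (forall p, In p X -> (col p < k)%nat) /\
    (forall p, In p X -> guarded f g V X col (m - k) (fun _ => False) p) /\
    (forall a b, rich V (quadrant f g a b) m -> hits_all V X (quadrant f g a b) col k).
Proof.
  intros N If Ig K.
  destruct (Nat.le_gt_cases m (length V)) as [h|h].
  - destruct (sorted_exists g V N Ig) as (P & PP & SP).
    assert (inP : forall p, In p P -> In p V) by (intros p; apply Permutation_in; now symmetry).
    assert (inV : forall p, In p V -> In p P) by (intros p; now apply Permutation_in).
    destruct (sweep_exists f g m k P) as (W & X & col & S); auto.
    { eapply Permutation_NoDup; eauto. }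
    { eapply inj_on_incl; eauto. }
    { now rewrite <- (Permutation_length PP). }
    exists X, col. destruct S as [sX scol snd slen sW slow sall sinj snew sguard shit].
    split; [|split; [|split]]; auto.
    + intros p Hp; auto.
    + intros p Hp. destruct (sguard p Hp) as (U & NU & LU & HU).
      exists U; split; [auto|split;[auto|]]. intros u Hu.
      destruct (HU u Hu) as (U1 & U2 & U3 & U4 & U5 & U6).
      do 5 (split; [now auto|]). now intros w [].
    + intros a b (E & NE & IE & RE & LE) c Hc. apply shit; auto.
      exists E; split; [auto|split; [|auto]]. intros e He; auto.
  - exists [], (fun _ => 0%nat). split; [easy|split; [easy|split; [easy|]]].
    intros a b (E & NE & IE & RE & LE).
    apply NoDup_incl_length in IE; auto; lia.
Qed.

(** * How many points of a range a guarded coloring can remove *)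

Lemma length_filter_filter (a b : point -> bool) L :
  (length (filter a (filter b L)) <= length (filter a L))%nat.
Proof.
  induction L as [|p L IH]; simpl; auto.
  destruct (b p); simpl; destruct (a p); simpl; lia.
Qed.

Lemma color_count t k (col : point -> nat) L :
  (forall p, In p L -> (col p < k)%nat) ->
  (forall c, (c < k)%nat -> (length (filter (fun p => col p =? c) L) <= t)%nat) ->
  (length L <= t * k)%nat.
Proof.
  revert L; induction k as [|k IH]; intros L C H.
  - destruct L as [|p L]; simpl; [lia|]. specialize (C p (or_introl eq_refl)); lia.
  - rewrite <- (filter_length (fun p => col p =? k) L).
    assert (H1 := H k (Nat.lt_succ_diag_r k)).
    assert (H2 : (length (filter (fun p => negb (col p =? k)) L) <= t * k)%nat); [|lia].
    apply IH.
    + intros p Hp. apply filter_In in Hp. destruct Hp as [Hp E].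
      apply negb_true_iff, Nat.eqb_neq in E. specialize (C p Hp); lia.
    + intros c Hc. eapply Nat.le_trans; [|apply (H c); lia].
      apply length_filter_filter.
Qed.

Lemma crowded_color f t k (col : point -> nat) L : NoDup L -> inj_on f L ->
  (forall p, In p L -> (col p < k)%nat) -> (t * k < length L)%nat ->
  exists c M, (t < length M)%nat /\ (forall p, In p M -> In p L /\ col p = c) /\
    StronglySorted (fun p q => f p < f q) M.
Proof.
  intros N I C H.
  destruct (classic (exists c, (t < length (filter (fun p => col p =? c) L))%nat)) as [(c & Hc)|n].
  - destruct (sorted_exists f (filter (fun p => col p =? c) L)) as (M & PM & SM).
    { now apply NoDup_filter. }
    { eapply inj_on_incl; [|exact I]. apply incl_filter. }
    exists c, M. rewrite <- (Permutation_length PM). repeat split; auto;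
    apply (Permutation_in p (Permutation_sym PM)), filter_In in H0.
    + tauto.
    + now apply Nat.eqb_eq.
  - exfalso. assert (length L <= t * k)%nat; [|lia].
    apply (color_count t k col); auto. intros c Hc.
    destruct (Nat.le_gt_cases (length (filter (fun p => col p =? c) L)) t); auto.
    exfalso; eauto.
Qed.

(** Pigeonhole on the [k] colors; [t] is 1 where two points of one color trap guards in the range,
    and 2 where three are needed. *)
Lemma rich_minus f V X r (col : point -> nat) k m t : inj_on f V ->
  (forall p, In p X -> (col p < k)%nat) -> rich V r m ->
  rich (minus V X) r (m - t * k) \/
  exists c M, (t < length M)%nat /\ (forall p, In p M -> In p X /\ r p /\ col p = c) /\
    StronglySorted (fun p q => f p < f q) M.
Proof.
  intros I C (E & NE & IE & RE & LE).
  assert (LL := length_minus E X).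
  destruct (Nat.le_gt_cases (length (filter (mem X) E)) (t * k)) as [h|h].
  - left. exists (minus E X). split; [now apply NoDup_minus|]. split; [|split].
    + intros p Hp. apply in_minus in Hp. apply in_minus. intuition.
    + intros p Hp. apply in_minus in Hp. apply RE; tauto.
    + lia.
  - right. destruct (crowded_color f t k col (filter (mem X) E)) as (c & M & M1 & M2 & M3); auto.
    { now apply NoDup_filter. }
    { eapply inj_on_incl; [|exact I]. intros p Hp. apply filter_In in Hp. apply IE; tauto. }
    { intros p Hp. apply filter_In in Hp. rewrite mem_spec in Hp. apply C; tauto. }
    exists c, M; repeat split; auto; apply M2 in H; destruct H as [H1 H2]; auto;
    apply filter_In in H1; rewrite mem_spec in H1; [tauto|apply RE; tauto].
Qed.

Lemma rich_guard f g V X col n p r : guarded f g V X col n (fun _ => False) p ->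
  (forall u, f p < f u ->
     (forall q, In q X -> col q = col p -> f q < f p -> g q < g u) ->
     (forall q, In q X -> col q = col p -> f p < f q -> f u < f q /\ g u < g q) -> r u) ->
  rich (minus V X) r n.
Proof.
  intros (U & NU & LU & HU) H. exists U. split; [auto|]. split; [|split; [|auto]].
  - intros u Hu. apply HU in Hu. apply in_minus; tauto.
  - intros u Hu. destruct (HU u Hu) as (_ & _ & U3 & U4 & U5 & _). now apply H.
Qed.

(** Two points of one color suffice in two situations: the range is a quadrant opening towards large
    [f] and [g] and catches the guards of the right point, or it is bottomless and catches those of
    the left point, which lie below the right one. *)
Lemma cost_one f g V X col k m (r : range) : inj_on f V ->
  (forall p, In p X -> (col p < k)%nat) ->
  (forall p, In p X -> guarded f g V X col (m - k) (fun _ => False) p) ->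
  (forall p q, r p -> r q -> f p < f q ->
     (forall u, f q < f u -> g p < g u -> r u) \/
     (forall u, f p < f u -> f u < f q -> g u < g q -> r u)) ->
  rich V r m -> rich (minus V X) r (m - k).
Proof.
  intros I C G H HE.
  destruct (rich_minus f V X r col k m 1 I C HE) as [h|(c & M & M1 & M2 & M3)].
  { eapply rich_le; [|exact h]; lia. }
  destruct M as [|p [|q M]]; simpl in M1; try lia.
  inversion M3 as [|? ? _ F]; subst. inversion F as [|? ? hpq _]; subst.
  destruct (M2 p) as (pX & pr & pc); simpl; auto.
  destruct (M2 q) as (qX & qr & qc); simpl; auto.
  destruct (H p q pr qr hpq) as [h|h].
  - eapply rich_guard; [apply (G q qX)|]. intros u u1 u2 u3. apply h; auto. apply u2; auto. congruence.
  - eapply rich_guard; [apply (G p pX)|]. intros u u1 u2 u3.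
    destruct (u3 q); auto; congruence.
Qed.

(** Of three points of one color, the guards of the middle one lie in the box spanned by the outer
    two: above the first, below the third, and between the middle and the third in [f]. *)
Lemma cost_two f g V X col k m (r : range) : inj_on f V ->
  (forall p, In p X -> (col p < k)%nat) ->
  (forall p, In p X -> guarded f g V X col (m - k) (fun _ => False) p) ->
  (forall p q u, r p -> r q -> f p < f u -> f u < f q -> g p < g u -> g u < g q -> r u) ->
  rich V r m -> rich (minus V X) r (m - 2 * k).
Proof.
  intros I C G H HE.
  destruct (rich_minus f V X r col k m 2 I C HE) as [h|(c & M & M1 & M2 & M3)]; auto.
  destruct M as [|p [|q [|z M]]]; simpl in M1; try lia.
  inversion M3 as [|? ? M4 F]; subst. inversion F as [|? ? hpq _]; subst.
  inversion M4 as [|? ? _ F']; subst. inversion F' as [|? ? hqz _]; subst.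
  destruct (M2 p) as (pX & pr & pc); simpl; auto.
  destruct (M2 q) as (qX & qr & qc); simpl; auto.
  destruct (M2 z) as (zX & zr & zc); simpl; auto.
  apply rich_le with (m - k)%nat; [lia|].
  eapply rich_guard; [apply (G q qX)|]. intros u u1 u2 u3.
  destruct (u3 z); auto; [congruence|].
  apply (H p z); auto; [lra|]. apply u2; auto. congruence.
Qed.

(** * Bottomless rectangles *)

(** A value of at least [k] means that the point is still uncolored; such points are exempt here,
    and they are the only ones that [extends] allows to change. *)
Definition spread (P : list point) (f : point -> R) (col : point -> nat) (k : nat) : Prop :=
  forall p q, In p P -> In q P -> col p = col q -> (col p < k)%nat -> f p < f q ->
  exists U, NoDup U /\ (k <= S (length U))%nat /\
    forall u, In u U -> In u P /\ f p < f u /\ f u < f q.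

Definition extends (k : nat) (col col' : point -> nat) : Prop :=
  forall p, (col p < k)%nat -> col' p = col p.

Definition window_hit (P : list point) (f : point -> R) (col : point -> nat) (k c : nat) : Prop :=
  forall a b, rich P (fun p => a <= f p <= b) (3 * k - 2) ->
  exists p, In p P /\ a <= f p <= b /\ col p = c.

Definition within (f : point -> R) (a b : R) (p : point) : bool :=
  if Rle_dec a (f p) then if Rle_dec (f p) b then true else false else false.

Lemma within_spec f a b p : within f a b p = true <-> a <= f p <= b.
Proof.
  unfold within. destruct (Rle_dec a (f p)), (Rle_dec (f p) b); split; intros; auto; easy || lra.
Qed.

Lemma in_within f a b P p : In p (filter (within f a b) P) <-> In p P /\ a <= f p <= b.
Proof. now rewrite filter_In, within_spec. Qed.

Lemma sorted_app_lt (f : point -> R) A B :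
  StronglySorted (fun p q => f p < f q) (A ++ B) -> forall a b, In a A -> In b B -> f a < f b.
Proof.
  induction A as [|x A IH]; simpl; intros S a b Ha Hb; [easy|].
  inversion S as [|? ? S' F]; subst. destruct Ha as [<-|Ha]; auto.
  rewrite Forall_forall in F. apply F, in_or_app; auto.
Qed.

(** The [k] consecutive points of [M] cannot repeat a color, as [k - 1] points would lie between two
    equal ones. If all were colored, they would show [k] distinct colors other than [c]. *)
Lemma uncolored_in_middle P f col k c a b A M B :
  spread P f col k -> (1 <= k)%nat -> (c < k)%nat ->
  (forall p, In p P -> a <= f p <= b -> col p <> c) ->
  Permutation (filter (within f a b) P) (A ++ M ++ B) ->
  (forall x y, In x A -> In y M -> f x < f y) -> (forall x y, In x M -> In y B -> f x < f y) ->
  inj_on f P -> NoDup M -> length M = k -> exists q, In q M /\ (k <= col q)%nat.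
Proof.
  intros S K Hc free PM AM MB I NM LM.
  assert (inE : forall p, In p P /\ a <= f p <= b <-> In p A \/ In p M \/ In p B).
  { intros p. rewrite <- in_within, <- !in_app_iff. split; apply Permutation_in; auto.
    now symmetry. }
  destruct (classic (exists q, In q M /\ (k <= col q)%nat)) as [|n]; auto. exfalso.
  assert (cM : forall p, In p M -> (col p < k)%nat).
  { intros p Hp. destruct (Nat.le_gt_cases k (col p)); auto. exfalso; eauto. }
  assert (inj : forall p q, In p M -> In q M -> col p = col q -> ~ f p < f q).
  { intros p q Hp Hq E h.
    destruct (proj2 (inE p)) as [pP pI]; auto. destruct (proj2 (inE q)) as [qP qI]; auto.
    destruct (S p q) as (U & NU & LU & HU); auto.
    assert (H : incl (p :: q :: U) M).
    { intros u [<-|[<-|Hu]]; auto. destruct (HU u Hu) as (u1 & u2 & u3).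
      destruct (proj1 (inE u)) as [H|[H|H]]; auto.
      - split; auto; lra.
      - specialize (AM u p H Hp); lra.
      - specialize (MB q u Hq H); lra. }
    apply NoDup_incl_length in H; [simpl in H; lia|].
    constructor; [|constructor; auto].
    - intros [<-|Hp']; [lra|]. apply HU in Hp'; lra.
    - intros Hq'. apply HU in Hq'; lra. }
  assert (L : (length (c :: map col M) <= length (seq 0 k))%nat).
  { apply NoDup_incl_length.
    - constructor.
      + intros H. apply in_map_iff in H. destruct H as (p & E & Hp).
        destruct (proj2 (inE p)) as [pP pI]; auto. now apply (free p).
      + apply NoDup_map_NoDup_ForallPairs; auto. intros p q Hp Hq E.
        destruct (Rtotal_order (f p) (f q)) as [h|[h|h]].
        * now destruct (inj p q).
        * apply I; auto; apply inE; auto.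
        * now destruct (inj q p).
    - intros d [<-|Hd]; apply in_seq; [lia|].
      apply in_map_iff in Hd. destruct Hd as (p & <- & Hp). specialize (cM p Hp); lia. }
  simpl in L. rewrite length_map, length_seq in L. lia.
Qed.

(* A window violating the condition for color [c] consists of exactly [3k-2] points, one of
   them new; an uncolored point among its middle [k] points may receive [c]. *)
Lemma repair_color P v f col k c :
  NoDup (v :: P) -> inj_on f (v :: P) -> (1 <= k)%nat -> (c < k)%nat ->
  spread (v :: P) f col k -> window_hit P f col k c ->
  exists col', extends k col col' /\ spread (v :: P) f col' k /\ window_hit (v :: P) f col' k c.
Proof.
  intros N I K Hc Sp H.
  destruct (classic (window_hit (v :: P) f col k c)) as [|n].
  { exists col; split; [now intros p|auto]. }
  apply not_all_ex_not in n. destruct n as (a & n).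
  apply not_all_ex_not in n. destruct n as (b & n).
  apply imply_to_and in n. destruct n as [HE n].
  inversion N as [|? ? Nv NP]; subst.
  assert (free : forall p, In p (v :: P) -> a <= f p <= b -> col p <> c).
  { intros p H1 H2 H3. apply n. now exists p. }
  assert (small : forall a' b', (forall p, In p P -> a' <= f p <= b' -> col p <> c) ->
            (length (filter (within f a' b') P) < 3 * k - 2)%nat).
  { intros a' b' fr. apply Nat.nle_gt. intros h.
    destruct (H a' b') as (p & H1 & H2 & H3); [|now apply (fr p)].
    exists (filter (within f a' b') P). split; [now apply NoDup_filter|]. split; [apply incl_filter|].
    split; auto. intros p Hp. now apply in_within in Hp. }
  assert (newin : forall a' b', rich (v :: P) (fun p => a' <= f p <= b') (3 * k - 2) ->
            (forall p, In p P -> a' <= f p <= b' -> col p <> c) -> a' <= f v <= b').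
  { intros a' b' (E & NE & IE & RE & LE) fr.
    destruct (in_dec point_eq_dec v E) as [h|h]; auto. exfalso.
    specialize (small a' b' fr).
    assert (J : incl E (filter (within f a' b') P)).
    { intros e He. apply in_within. split; auto. destruct (IE e He) as [<-|]; auto; easy. }
    apply NoDup_incl_length in J; auto; lia. }
  assert (hv : a <= f v <= b) by (apply newin; auto; intros p Hp; apply free; now right).
  set (E := filter (within f a b) (v :: P)).
  assert (NE : NoDup E) by now apply NoDup_filter.
  assert (LE : length E = (3 * k - 2)%nat).
  { assert (L1 : (length (filter (within f a b) P) < 3 * k - 2)%nat).
    { apply small. intros p Hp; apply free; now right. }
    assert (L2 : length E = S (length (filter (within f a b) P))).
    { unfold E; simpl. apply within_spec in hv. now rewrite hv. }
    destruct HE as (E' & NE' & IE' & RE' & LE').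
    assert (incl E' E) by (intros e He; apply in_within; auto).
    apply NoDup_incl_length in H0; auto. lia. }
  destruct (sorted_exists f E) as (L & PL & SL); auto.
  { eapply inj_on_incl; [|exact I]. apply incl_filter. }
  (* Origin of [3 * k - 2]: among [k] middle points one is uncolored, and [k - 1] points on either
     side separate it from the nearest points of color [c], which lie outside the window. *)
  set (A := firstn (k - 1) L). set (T := skipn (k - 1) L).
  set (M := firstn k T). set (B := skipn k T).
  assert (EL : L = A ++ M ++ B) by (unfold A, M, B, T; now rewrite !firstn_skipn).
  assert (LL := Permutation_length PL).
  assert (LA : length A = (k - 1)%nat) by (unfold A; rewrite firstn_length_le; lia).
  assert (LM : length M = k).
  { unfold M. rewrite firstn_length_le; auto. unfold T; rewrite length_skipn; lia. }
  assert (LB : length B = (k - 1)%nat).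
  { rewrite EL, !length_app in LL. lia. }
  assert (NL : NoDup (A ++ M ++ B)) by (rewrite <- EL; eapply Permutation_NoDup; eauto).
  rewrite EL in PL, SL.
  assert (lt1 := sorted_app_lt f A (M ++ B) SL).
  assert (lt2 : forall x y, In x M -> In y B -> f x < f y).
  { rewrite app_assoc in SL. intros x y Hx Hy. apply (sorted_app_lt f (A ++ M) B SL); auto.
    apply in_or_app; auto. }
  assert (NA : NoDup A) by (eapply NoDup_app_remove_r; eauto).
  assert (NMB : NoDup (M ++ B)) by (eapply NoDup_app_remove_l; eauto).
  assert (NM : NoDup M) by (eapply NoDup_app_remove_r; eauto).
  assert (NB : NoDup B) by (eapply NoDup_app_remove_l; eauto).
  assert (inE : forall p, In p A \/ In p M \/ In p B -> In p (v :: P) /\ a <= f p <= b).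
  { intros p Hp. apply in_within. eapply Permutation_in; [symmetry; exact PL|].
    rewrite !in_app_iff; tauto. }
  destruct (uncolored_in_middle (v :: P) f col k c a b A M B) as (q & qM & qc); auto.
  { intros x y Hx Hy. apply lt1; auto. apply in_or_app; auto. }
  destruct (inE q) as [qP qI]; auto.
  set (col' := fun p => if point_eq_dec p q then c else col p).
  assert (cq : col' q = c) by (unfold col'; now destruct (point_eq_dec q q)).
  assert (cn : forall p, p <> q -> col' p = col p).
  { intros p h. unfold col'. now destruct (point_eq_dec p q). }
  assert (ext : extends k col col').
  { intros p Hp. apply cn. intros ->. lia. }
  exists col'; split; [auto|split].
  - intros p z Hp Hz E0 Cp h.
    destruct (point_eq_dec p q) as [->|hp], (point_eq_dec z q) as [->|hz].
    + lra.
    + rewrite cq, cn in E0 by auto. exists B; split; [auto|split; [lia|]].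
      intros u Hu. destruct (inE u) as [uP uI]; auto. split; [auto|split; [auto|]].
      destruct (Rlt_dec b (f z)); [lra|]. exfalso; apply (free z); auto. lra.
    + rewrite cq, cn in E0 by auto. exists A; split; [auto|split; [lia|]].
      intros u Hu. destruct (inE u) as [uP uI]; auto. split; [auto|split].
      * destruct (Rlt_dec (f p) a); [lra|]. exfalso; apply (free p); auto. lra.
      * apply lt1; auto. apply in_or_app; auto.
    + rewrite !cn in * by auto. auto.
  (* A second bad window would contain [v] but not [q]. Its union with the first is an interval of
     [f] free of [c] in the old coloring, so it has at most [3 * k - 3] points of [P]; yet it
     contains [q] and [3 * k - 2] further points, all but [v] from [P]. *)
  - intros a' b' HE'. apply NNPP. intros n'.
    assert (free' : forall p, In p (v :: P) -> a' <= f p <= b' -> p <> q /\ col p <> c).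
    { intros p Hp hp. assert (p <> q) by (intros ->; eauto).
      split; auto. intros E0. apply n'. exists p. rewrite cn; auto. }
    assert (hv' : a' <= f v <= b').
    { apply newin; auto. intros p Hp hp. apply free'; auto. now right. }
    set (a0 := Rmin a a'). set (b0 := Rmax b b').
    assert (sm : (length (filter (within f a0 b0) P) < 3 * k - 2)%nat).
    { apply small. intros p Hp hp.
      destruct (classic (a <= f p <= b)) as [h|h]; [apply free; auto; now right|].
      apply free'; [now right|]. revert hp h. unfold a0, b0, Rmin, Rmax.
      destruct (Rle_dec a a'), (Rle_dec b b'); intros; lra. }
    destruct HE' as (E' & NE' & IE' & RE' & LE').
    assert (J : incl (q :: E') (filter (within f a0 b0) (v :: P))).
    { intros e [<-|He]; apply in_within; split; auto.
      - unfold a0, b0. generalize (Rmin_l a a') (Rmax_l b b'). lra.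
      - specialize (RE' e He). generalize (Rmin_r a a') (Rmax_r b b'). unfold a0, b0. lra. }
    apply NoDup_incl_length in J.
    2:{ constructor; auto. intros Hq. destruct (free' q); auto. }
    assert (L3 : (length (filter (within f a0 b0) (v :: P)) <= S (length (filter (within f a0 b0) P)))%nat).
    { simpl. destruct (within f a0 b0 v); simpl; lia. }
    simpl in J, L3. lia.
Qed.

Lemma extends_hit P f k col col' c : (c < k)%nat -> extends k col col' ->
  window_hit P f col k c -> window_hit P f col' k c.
Proof.
  intros Hc X H a b HE. destruct (H a b HE) as (p & H1 & H2 & H3).
  exists p; rewrite (X p); subst; auto.
Qed.

Lemma extends_trans k col col' col'' :
  extends k col col' -> extends k col' col'' -> extends k col col''.
Proof. intros H1 H2 p Hp. rewrite H2; rewrite H1; auto. Qed.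

(** One color is repaired at a time. Colors already given are never changed, so the colors repaired
    earlier stay correct. *)
Lemma repair_colors P v f col k :
  NoDup (v :: P) -> inj_on f (v :: P) -> (1 <= k)%nat ->
  spread (v :: P) f col k -> (forall c, (c < k)%nat -> window_hit P f col k c) ->
  forall j, (j <= k)%nat -> exists col', extends k col col' /\ spread (v :: P) f col' k /\
    forall c, (c < j)%nat -> window_hit (v :: P) f col' k c.
Proof.
  intros N I K S H j. induction j as [|j IH]; intros Hj.
  - exists col; split; [now intros p|split; [auto|lia]].
  - destruct IH as (col1 & X1 & S1 & H1); [lia|].
    destruct (repair_color P v f col1 k j) as (col2 & X2 & S2 & H2); auto.
    { eapply extends_hit; eauto. }
    exists col2; split; [eapply extends_trans; eauto|split; [auto|]].
    intros c Hc. destruct (Nat.eq_dec c j) as [->|]; auto.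
    eapply extends_hit; eauto; [lia|]. apply H1; lia.
Qed.

(** Sorting by [- g] makes the induction insert points by increasing height. A rectangle reaching up
    to the newest point is just an interval of [f]; a lower one sees only earlier points, whose
    colors are kept. *)
Lemma bottomless_coloring f g V k : NoDup V -> inj_on f V -> inj_on g V -> (1 <= k)%nat ->
  exists col, forall a1 a2 b,
    rich V (fun p => a1 <= f p /\ f p <= a2 /\ g p <= b) (3 * k - 2) ->
    hits_all V V (fun p => a1 <= f p /\ f p <= a2 /\ g p <= b) col k.
Proof.
  intros N If Ig K.
  destruct (sorted_exists (fun p => - g p) V N (inj_on_opp g V Ig)) as (P & PP & SP).
  cut (exists col, spread P f col k /\ (forall c, (c < k)%nat -> window_hit P f col k c) /\
    forall a1 a2 b,
      rich P (fun p => a1 <= f p /\ f p <= a2 /\ g p <= b) (3 * k - 2) ->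
      hits_all P P (fun p => a1 <= f p /\ f p <= a2 /\ g p <= b) col k).
  { intros (col & _ & _ & H). exists col. intros a1 a2 b (E & NE & IE & RE & LE) c Hc.
    destruct (H a1 a2 b) with (c := c) as (p & H1 & H2); auto.
    - exists E; split; [auto|split; [|auto]]. intros e He. apply (Permutation_in e PP); auto.
    - exists p; split; auto. apply (Permutation_in p (Permutation_sym PP)); auto. }
  assert (NP : NoDup P) by (eapply Permutation_NoDup; eauto).
  assert (IP : inj_on f P).
  { eapply inj_on_incl; [|exact If]. intros p; apply Permutation_in; now symmetry. }
  clear N If Ig PP V.
  induction P as [|v P IH].
  - exists (fun _ => k). split; [|split]; [easy| |].
    + intros c Hc a b (E & NE & IE & RE & LE). apply NoDup_incl_length in IE; auto. simpl in IE; lia.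
    + intros a1 a2 b (E & NE & IE & RE & LE). apply NoDup_incl_length in IE; auto. simpl in IE; lia.
  - inversion NP as [|? ? Nv NP']; subst. inversion SP as [|? ? SP' F]; subst.
    assert (IP' : inj_on f P) by (eapply inj_on_incl; [|exact IP]; intros ? ?; now right).
    destruct (IH SP' NP' IP') as (col & S & H & Hb).
    set (col0 := fun p => if point_eq_dec p v then k else col p).
    assert (c0 : forall p, In p P -> col0 p = col p).
    { intros p Hp. unfold col0. destruct (point_eq_dec p v) as [->|]; easy. }
    assert (cv : col0 v = k) by (unfold col0; now destruct (point_eq_dec v v)).
    destruct (repair_colors P v f col0 k) with (j := k) as (col1 & X1 & S1 & H1); auto.
    { intros p q [<-|Hp] [<-|Hq] E Cp h; try (rewrite ?cv in *; lia); try lra.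
      rewrite !c0 in * by auto. destruct (S p q) as (U & NU & LU & HU); auto.
      exists U; split; [auto|split; [auto|]]. intros u Hu. split; [right|]; now apply HU. }
    { intros c Hc a b HE. destruct (H c Hc a b HE) as (p & p1 & p2 & p3).
      exists p. rewrite c0; auto. }
    exists col1; split; [auto|split; [auto|]].
    intros a1 a2 b (E & NE & IE & RE & LE) c Hc.
    destruct (Rle_dec (g v) b) as [h|h].
    + destruct (H1 c Hc a1 a2) as (p & p1 & p2 & p3).
      { exists E; split; [auto|split; [auto|split; [|auto]]]. intros p Hp; apply RE in Hp; lra. }
      exists p; split; [auto|split; [|auto]]. split; [lra|split; [lra|]].
      destruct p1 as [<-|p1]; auto. rewrite Forall_forall in F. apply F in p1; lra.
    + destruct (Hb a1 a2 b) with (c := c) as (p & p1 & p2 & p3); auto.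
      { exists E; split; [auto|split; [|auto]]. intros p Hp.
        destruct (IE p Hp) as [<-|]; auto. apply RE in Hp; lra. }
      exists p; split; [now right|split; [auto|]]. rewrite X1, c0; auto. rewrite c0, p3; auto.
Qed.

(** * Sums over finite sets and rounding *)

Definition rsum (h : point -> R) (L : list point) : R :=
  fold_right (fun p s => h p + s) 0 L.

Lemma rsum_app h L L' : rsum h (L ++ L') = rsum h L + rsum h L'.
Proof. induction L as [|p L IH]; simpl; lra. Qed.

Lemma rsum_perm h L L' : Permutation L L' -> rsum h L = rsum h L'.
Proof. induction 1; simpl; lra. Qed.

Lemma rsum_ext h h' L : (forall p, In p L -> h p = h' p) -> rsum h L = rsum h' L.
Proof.
  induction L as [|p L IH]; simpl; intros H; auto.
  rewrite (H p), IH; auto.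
Qed.

Lemma rsum_linear h h' c L : rsum (fun p => h p + c * h' p) L = rsum h L + c * rsum h' L.
Proof. induction L as [|p L IH]; simpl; [lra|]. rewrite IH; lra. Qed.

Lemma rsum_const c L : rsum (fun _ => c) L = c * INR (length L).
Proof.
  induction L as [|p L IH]; [simpl; lra|].
  change (length (p :: L)) with (S (length L)). rewrite S_INR.
  change (rsum (fun _ => c) (p :: L)) with (c + rsum (fun _ => c) L). rewrite IH; lra.
Qed.

Lemma rsum_zero h L : (forall p, In p L -> h p = 0) -> rsum h L = 0.
Proof. intros H. rewrite (rsum_ext h (fun _ => 0)), rsum_const by auto; lra. Qed.

Lemma rsum_filter h a L : (forall p, In p L -> a p = false -> h p = 0) ->
  rsum h (filter a L) = rsum h L.
Proof.
  induction L as [|p L IH]; simpl; intros H; auto.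
  assert (IH' := IH (fun q Hq => H q (or_intror Hq))).
  destruct (a p) eqn:E; simpl; [lra|]. rewrite H; auto; lra.
Qed.

Lemma rsum_small h L : (forall p, In p L -> -1 < h p < 1) -> L <> [] ->
  - INR (length L) < rsum h L < INR (length L).
Proof.
  induction L as [|p L IH]; intros H n; [easy|].
  change (length (p :: L)) with (S (length L)). rewrite S_INR. simpl rsum.
  assert (Hp := H p (or_introl eq_refl)).
  destruct L as [|q L]; [simpl; lra|].
  assert (IH' : - INR (length (q :: L)) < rsum h (q :: L) < INR (length (q :: L))).
  { apply IH; [|easy]. intros z Hz; apply H; now right. }
  lra.
Qed.

(** Gaussian elimination: the first functional [e] is solved for a pivot [p] with [e p <> 0] after
    its multiples have cleared [p] from the other functionals; if it vanishes on [F], it is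
    dropped. *)
Lemma homogeneous_solution n : forall (Es : list (point -> R)) F, length Es = n -> NoDup F ->
  (n < length F)%nat ->
  exists y, (exists p, In p F /\ y p <> 0) /\ (forall p, ~ In p F -> y p = 0) /\
    forall e, In e Es -> rsum (fun p => e p * y p) F = 0.
Proof.
  induction n as [|n IH]; intros [|e Es] F LE NF L; try easy.
  - destruct F as [|p F]; [simpl in L; lia|].
    exists (fun q => if in_dec point_eq_dec q (p :: F) then 1 else 0).
    split; [|split; [|easy]].
    + exists p; split; [now left|]. destruct (in_dec point_eq_dec p (p :: F)) as [|h]; [lra|].
      exfalso; apply h; now left.
    + intros q Hq. now destruct (in_dec point_eq_dec q (p :: F)).
  - injection LE as LE.
    destruct (classic (exists p, In p F /\ e p <> 0)) as [(p & Hp & ep)|h].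
    + destruct (in_split p F Hp) as (A & B & EF).
      assert (PF : Permutation F (p :: A ++ B)).
      { subst F. symmetry; apply Permutation_middle. }
      assert (NF' : NoDup (p :: A ++ B)) by (eapply Permutation_NoDup; eauto).
      rewrite (Permutation_length PF) in L. simpl in L.
      remember (A ++ B) as G eqn:EG. clear EG EF A B.
      inversion NF' as [|? ? NpG NG]; subst.
      destruct (IH (map (fun g q => g q - g p / e p * e q) Es) G) as (y & (z & zG & yz) & yoff & yeq);
        auto; [apply length_map|lia|].
      set (s := rsum (fun q => e q * y q) G).
      exists (fun q => if point_eq_dec q p then - s / e p else y q).
      assert (sum : forall g, rsum (fun q => g q * (if point_eq_dec q p then - s / e p else y q)) F
                = g p * (- s / e p) + rsum (fun q => g q * y q) G).
      { intros g. rewrite (rsum_perm _ _ _ PF). simpl.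
        destruct (point_eq_dec p p) as [_|]; [|easy]. f_equal. apply rsum_ext.
        intros q Hq. destruct (point_eq_dec q p) as [->|]; easy. }
      assert (inF : forall q, In q (p :: G) <-> In q F).
      { intros q; split; apply Permutation_in; auto. now symmetry. }
      split; [|split].
      * exists z; split; [apply inF; now right|].
        destruct (point_eq_dec z p) as [->|]; easy.
      * intros q Hq. destruct (point_eq_dec q p) as [->|]; [easy|].
        apply yoff. intros H; apply Hq, inF; now right.
      * intros g [<-|Hg]; rewrite sum.
        { fold s. field; auto. }
        assert (E := yeq _ (in_map (fun g q => g q - g p / e p * e q) Es g Hg)). simpl in E.
        rewrite (rsum_ext _ (fun q => g q * y q + (- (g p / e p)) * (e q * y q))) in E
          by (intros; lra).
        rewrite rsum_linear in E. fold s in E.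
        replace (rsum (fun q => g q * y q) G) with (g p / e p * s) by lra. field; auto.
    + destruct (IH Es F) as (y & y1 & y2 & y3); auto; [lia|].
      exists y; split; [auto|split; [auto|]]. intros g [<-|Hg]; auto.
      apply rsum_zero. intros p Hp. assert (e p = 0); [|nra].
      apply NNPP; intros H; eauto.
Qed.

Lemma rsum_indicator y F b : NoDup F -> NoDup b -> (forall p, ~ In p F -> y p = 0) ->
  rsum (fun p => (if mem b p then 1 else 0) * y p) F = rsum y b.
Proof.
  intros NF Nb off.
  rewrite <- (rsum_filter y (mem F) b).
  2:{ intros p _ H. apply off. rewrite <- mem_spec. now rewrite H. }
  rewrite <- (rsum_filter _ (mem b) F).
  2:{ intros p _ H. rewrite H; lra. }
  rewrite (rsum_ext _ y).
  2:{ intros p Hp. apply filter_In in Hp. destruct Hp as [_ ->]; lra. }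
  apply rsum_perm, NoDup_Permutation; try now apply NoDup_filter.
  intros p. rewrite !filter_In, !mem_spec. tauto.
Qed.

(* The moves that keep the weight of every block with more than [t] points in the support;
   their existence drives the iterated rounding of Beck and Fiala. *)
Definition balanced (t : nat) (BB : list (list point)) : Prop :=
  forall F, NoDup F -> F <> [] -> exists y, (exists p, In p F /\ y p <> 0) /\
    (forall p, ~ In p F -> y p = 0) /\
    forall b, In b BB -> (t < length (filter (mem F) b))%nat -> rsum y b = 0.

Definition active (t : nat) (F : list point) (BB : list (list point)) : list (list point) :=
  filter (fun b => t <? length (filter (mem F) b)) BB.

Lemma in_active t F BB b :
  In b (active t F BB) <-> In b BB /\ (t < length (filter (mem F) b))%nat.
Proof. unfold active. now rewrite filter_In, Nat.ltb_lt. Qed.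

Lemma kernel_of_blocks F BB : NoDup F -> (forall b, In b BB -> NoDup b) ->
  (length BB < length F)%nat ->
  exists y, (exists p, In p F /\ y p <> 0) /\ (forall p, ~ In p F -> y p = 0) /\
    forall b, In b BB -> rsum y b = 0.
Proof.
  intros NF NB L.
  destruct (homogeneous_solution _ (map (fun b p => if mem b p then 1 else 0) BB) F eq_refl NF)
    as (y & y1 & y2 & y3); [now rewrite length_map|].
  exists y; split; [auto|split; [auto|]]. intros b Hb.
  rewrite <- (rsum_indicator y F b) by auto.
  apply (y3 (fun p => if mem b p then 1 else 0)).
  apply (in_map (fun b p => if mem b p then 1 else 0) BB b Hb).
Qed.

Lemma active_cat t F B1 B2 : active t F (B1 ++ B2) = active t F B1 ++ active t F B2.
Proof. apply filter_app. Qed.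

Lemma active_incidences t F BB :
  (S t * length (active t F BB) <= length (filter (mem F) (concat (active t F BB))))%nat.
Proof.
  unfold active. induction BB as [|b BB IH]; [simpl; lia|].
  cbn [filter]. destruct (t <? length (filter (mem F) b)) eqn:E; auto.
  apply Nat.ltb_lt in E. cbn [concat length]. rewrite filter_app, length_app. lia.
Qed.

Lemma NoDup_app_inv (L L' : list point) : NoDup (L ++ L') ->
  NoDup L /\ NoDup L' /\ forall p, In p L -> ~ In p L'.
Proof.
  intros N. split; [eapply NoDup_app_remove_r; eauto|].
  split; [eapply NoDup_app_remove_l; eauto|].
  induction L as [|x L IH]; simpl in *; [easy|]. inversion N as [|? ? H N']; subst.
  intros p [<-|Hp]; [|now apply IH]. intros h; apply H, in_or_app; auto.
Qed.

Lemma NoDup_concat_filter (a : list point -> bool) BB :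
  NoDup (concat BB) -> NoDup (concat (filter a BB)).
Proof.
  induction BB as [|b BB IH]; simpl; intros N; auto.
  destruct (NoDup_app_inv _ _ N) as (N1 & N2 & N3).
  destruct (a b); simpl; auto.
  apply NoDup_app; auto. intros p Hp H. apply (N3 p Hp).
  apply in_concat in H. destruct H as (b' & Hb' & H). apply filter_In in Hb'.
  apply in_concat. exists b'; tauto.
Qed.

Lemma incident_incl F (L : list point) : incl (filter (mem F) L) F.
Proof. intros p Hp. apply filter_In in Hp. now rewrite mem_spec in Hp. Qed.

(** Disjoint blocks take at least [t + 1] different points of [F] each. *)
Lemma active_count t F BB : NoDup (concat BB) -> NoDup F ->
  (S t * length (active t F BB) <= length F)%nat.
Proof.
  intros N NF. eapply Nat.le_trans; [apply active_incidences|].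
  apply NoDup_incl_length; [|apply incident_incl].
  now apply NoDup_filter, NoDup_concat_filter.
Qed.

(** With four points of [F] per active block, each system gives at most a quarter of [length F]
    equations, so three systems leave a free direction. *)
Lemma balanced_three B1 B2 B3 : NoDup (concat B1) -> NoDup (concat B2) -> NoDup (concat B3) ->
  (forall b, In b (B1 ++ B2 ++ B3) -> NoDup b) -> balanced 3 (B1 ++ B2 ++ B3).
Proof.
  intros N1 N2 N3 N F NF nF.
  assert (H1 := active_count 3 F B1 N1 NF).
  assert (H2 := active_count 3 F B2 N2 NF).
  assert (H3 := active_count 3 F B3 N3 NF).
  destruct (kernel_of_blocks F (active 3 F (B1 ++ B2 ++ B3))) as (y & y1 & y2 & y3); auto.
  - intros b Hb. apply in_active in Hb. now apply N.
  - rewrite !active_cat, !length_app. destruct F; [easy|]. simpl length in *. lia.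
  - exists y; split; [auto|split; [auto|]]. intros b Hb h. apply y3, in_active; auto.
Qed.

Lemma rsum_concat_zero y BB : (forall b, In b BB -> rsum y b = 0) -> rsum y (concat BB) = 0.
Proof.
  induction BB as [|b BB IH]; simpl; intros H; auto.
  rewrite rsum_app, H, IH; auto; lra.
Qed.

Lemma rsum_covering y F BB : NoDup (concat BB) -> NoDup F -> (forall p, ~ In p F -> y p = 0) ->
  (length F <= length (filter (mem F) (concat BB)))%nat -> rsum y (concat BB) = rsum y F.
Proof.
  intros N NF off L.
  rewrite <- (rsum_filter y (mem F)).
  2:{ intros p _ H. apply off. rewrite <- mem_spec. now rewrite H. }
  apply rsum_perm, NoDup_Permutation_bis; auto; try now apply NoDup_filter.
  apply incident_incl.
Qed.

(* If there are as many active blocks as points of [F], both systems partition [F]; the rows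
   of either system then have the same sum, so one equation is redundant. *)
Lemma balanced_two B1 B2 : NoDup (concat B1) -> NoDup (concat B2) ->
  (forall b, In b (B1 ++ B2) -> NoDup b) -> balanced 1 (B1 ++ B2).
Proof.
  intros N1 N2 N F NF nF.
  assert (H1 := active_count 1 F B1 N1 NF).
  assert (H2 := active_count 1 F B2 N2 NF).
  assert (I1 := active_incidences 1 F B1).
  assert (I2 := active_incidences 1 F B2).
  assert (M1 : NoDup (concat (active 1 F B1))) by now apply NoDup_concat_filter.
  assert (M2 : NoDup (concat (active 1 F B2))) by now apply NoDup_concat_filter.
  destruct (Nat.lt_ge_cases (length (active 1 F B1) + length (active 1 F B2)) (length F)) as [h|h].
  - destruct (kernel_of_blocks F (active 1 F (B1 ++ B2))) as (y & y1 & y2 & y3); auto.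
    + intros b Hb. apply in_active in Hb. now apply N.
    + now rewrite !active_cat, !length_app.
    + exists y; split; [auto|split; [auto|]]. intros b Hb hb. apply y3, in_active; auto.
  - destruct (active 1 F B2) as [|b0 A2] eqn:E2.
    { destruct F; [easy|simpl in *; lia]. }
    assert (NA : forall b, In b (active 1 F B1 ++ b0 :: A2) -> NoDup b).
    { intros b Hb. rewrite <- E2, <- active_cat in Hb. apply in_active in Hb. now apply N. }
    destruct (kernel_of_blocks F (active 1 F B1 ++ A2)) as (y & y1 & y2 & y3); auto.
    + intros b Hb. apply NA. apply in_app_iff in Hb. apply in_app_iff; simpl; tauto.
    + rewrite length_app. simpl in h, H2. lia.
    + exists y; split; [auto|split; [auto|]].
      assert (Z1 : rsum y (concat (active 1 F B1)) = 0).
      { apply rsum_concat_zero. intros b Hb; apply y3, in_app_iff; auto. }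
      assert (Z2 : rsum y (concat A2) = 0).
      { apply rsum_concat_zero. intros b Hb; apply y3, in_app_iff; auto. }
      (* The sum over the first system passes to [F] and from there to [b0 :: A2], so the block
         [b0], whose equation was left out, has sum zero as well. *)
      rewrite (rsum_covering y F) in Z1 by (auto; simpl in *; lia).
      rewrite <- (rsum_covering y F (b0 :: A2)) in Z1 by (auto; simpl in *; lia).
      simpl in Z1. rewrite rsum_app, Z2 in Z1.
      intros b Hb hb.
      assert (Ha : In b (active 1 F B1 ++ b0 :: A2)).
      { rewrite <- E2, <- active_cat. apply in_active; auto. }
      apply in_app_iff in Ha. destruct Ha as [Ha|[<-|Ha]].
      * apply y3, in_app_iff; auto.
      * lra.
      * apply y3, in_app_iff; auto.
Qed.

Lemma filter_filter_sub (a c : point -> bool) L : (forall p, a p = true -> c p = true) ->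
  filter a (filter c L) = filter a L.
Proof.
  intros H. induction L as [|p L IH]; simpl; auto.
  destruct (c p) eqn:E; simpl; rewrite IH; auto.
  destruct (a p) eqn:E'; auto. rewrite (H p E') in E; easy.
Qed.

(** This permits recursion on color classes. A point of [F] outside [c] lies in no trimmed block, so
    its indicator is a free move; otherwise trimming loses no point of [F] and the old move
    works. *)
Lemma balanced_sub t BB (c : point -> bool) : balanced t BB -> balanced t (map (filter c) BB).
Proof.
  intros H F NF nF.
  destruct (classic (exists p, In p F /\ c p = false)) as [(p & Hp & cp)|n].
  - exists (fun q => if point_eq_dec q p then 1 else 0). split; [|split].
    + exists p; split; auto. destruct (point_eq_dec p p); [lra|easy].
    + intros q Hq. destruct (point_eq_dec q p) as [->|]; easy.
    + intros b Hb _. apply in_map_iff in Hb. destruct Hb as (b' & <- & _).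
      apply rsum_zero. intros q Hq. apply filter_In in Hq.
      destruct (point_eq_dec q p) as [->|]; auto. destruct Hq; congruence.
  - assert (cF : forall p, In p F -> c p = true).
    { intros p Hp. destruct (c p) eqn:E; auto. exfalso; eauto. }
    destruct (H F NF nF) as (y & y1 & y2 & y3).
    exists y; split; [auto|split; [auto|]]. intros b Hb h.
    apply in_map_iff in Hb. destruct Hb as (b' & <- & Hb').
    rewrite rsum_filter.
    + apply y3; auto. rewrite filter_filter_sub in h; auto.
      intros p Hp; apply cF. now apply mem_spec.
    + intros p _ cp. apply y2. intros Hp. rewrite cF in cp; easy.
Qed.

(** * Iterated rounding of a fractional vector *)

Lemma first_exit (x y : point -> R) F : (forall p, In p F -> 0 < x p < 1) ->
  (forall p, In p F -> y p = 0) \/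
  exists l, 0 < l /\ (forall p, In p F -> 0 <= x p + l * y p <= 1) /\
    exists p, In p F /\ (x p + l * y p = 0 \/ x p + l * y p = 1).
Proof.
  induction F as [|p F IH]; intros H; [now left|].
  assert (Hp := H p (or_introl eq_refl)).
  assert (ex : y p <> 0 -> exists l, 0 < l /\ (x p + l * y p = 0 \/ x p + l * y p = 1)).
  { intros yp. destruct (Rlt_dec 0 (y p)) as [h|h].
    - exists ((1 - x p) / y p). split; [apply Rdiv_lt_0_compat; lra|right; field; auto].
    - exists (x p / - y p). split; [apply Rdiv_lt_0_compat; lra|left; field; auto]. }
  destruct IH as [z|(l & l0 & lF & q & Hq & Eq)].
  { intros q Hq; apply H; now right. }
  - destruct (Req_EM_T (y p) 0) as [E|E].
    + left. intros q [<-|Hq]; auto.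
    + right. destruct (ex E) as (l & l0 & El). exists l; split; [auto|split].
      * intros q [<-|Hq]; [lra|]. rewrite (z q Hq). specialize (H q (or_intror Hq)). lra.
      * exists p; split; [now left|auto].
  - right. destruct (classic (0 <= x p + l * y p <= 1)) as [h|h].
    + exists l; split; [auto|split].
      * intros z [<-|Hz]; auto.
      * exists q; split; [now right|auto].
    (* Since [p] has already left the unit interval at [l], its own exit comes earlier and is safe
       for all other points. *)
    + destruct ex as (l' & l0' & El'). { intros E; rewrite E in h; lra. }
      assert (ll : l' < l) by (apply Rnot_le_lt; intros h'; apply h; destruct El'; nra).
      exists l'; split; [auto|split].
      * intros z [<-|Hz]; [lra|]. specialize (lF z Hz). specialize (H z (or_intror Hz)).
        destruct (Rle_dec 0 (y z)); nra.
      * exists p; split; [now left|auto].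
Qed.

Definition fractional (x : point -> R) (p : point) : bool :=
  if Rlt_dec 0 (x p) then if Rlt_dec (x p) 1 then true else false else false.

Lemma fractional_spec x p : fractional x p = true <-> 0 < x p < 1.
Proof.
  unfold fractional. destruct (Rlt_dec 0 (x p)), (Rlt_dec (x p) 1); split; intros; auto; easy || lra.
Qed.

Lemma in_fractional x U p : In p (filter (fractional x) U) <-> In p U /\ 0 < x p < 1.
Proof. now rewrite filter_In, fractional_spec. Qed.

Lemma round_step BB U t : NoDup U -> balanced t BB -> forall x,
  (forall p, 0 <= x p <= 1) -> filter (fractional x) U <> [] ->
  exists x', (forall p, 0 <= x' p <= 1) /\
    (forall p, ~ In p (filter (fractional x) U) -> x' p = x p) /\
    (length (filter (fractional x') U) < length (filter (fractional x) U))%nat /\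
    forall b, In b BB -> (t < length (filter (mem (filter (fractional x) U)) b))%nat ->
      rsum x' b = rsum x b.
Proof.
  intros NU Bal x x01 nF. set (F := filter (fractional x) U) in *.
  assert (NF : NoDup F) by now apply NoDup_filter.
  assert (FI : forall p, In p F -> 0 < x p < 1).
  { intros p Hp. apply in_fractional in Hp. tauto. }
  destruct (Bal F NF nF) as (y & (p0 & Hp0 & yp0) & y2 & y3).
  destruct (first_exit x y F FI) as [z|(l & l0 & lF & q & Hq & Eq)].
  { now rewrite z in yp0. }
  exists (fun p => x p + l * y p). split; [|split; [|split]].
  - intros p. destruct (in_dec point_eq_dec p F) as [h|h]; auto.
    rewrite (y2 p h). specialize (x01 p); lra.
  - intros p h. rewrite (y2 p h); lra.
  - assert (J : incl (q :: filter (fractional (fun p => x p + l * y p)) U) F).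
    { intros p [<-|Hp]; auto. apply in_fractional in Hp. destruct Hp as [pU hp].
      destruct (in_dec point_eq_dec p F) as [h|h]; auto.
      apply in_fractional. rewrite (y2 p h) in hp. split; auto; lra. }
    apply NoDup_incl_length in J; [simpl in J; lia|].
    constructor; [|now apply NoDup_filter].
    intros H. apply in_fractional in H. simpl in H. lra.
  - intros b Hb h. rewrite rsum_linear, y3; auto; lra.
Qed.

(** A block keeps its sum as long as more than [t] of its points are fractional. After that only
    these at most [t] points move, each by less than 1. The strict error makes rounding to an
    integer target exact for [t = 1]; a block without fractional points needs [0 < t]. *)
Lemma rounding BB U t : NoDup U -> (forall b, In b BB -> incl b U) -> balanced t BB ->
  (1 <= t)%nat -> forall n x, (length (filter (fractional x) U) <= n)%nat ->
  (forall p, 0 <= x p <= 1) ->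
  exists z, (forall p, In p U -> z p = 0 \/ z p = 1) /\
    (forall p, In p U -> x p = 0 \/ x p = 1 -> z p = x p) /\
    forall b, In b BB -> rsum x b - INR t < rsum z b < rsum x b + INR t.
Proof.
  intros NU IU Bal ht.
  assert (t0 : 0 < INR t) by (apply lt_0_INR; lia).
  assert (edge : forall x p, (forall q, 0 <= x q <= 1) -> In p U ->
            ~ In p (filter (fractional x) U) -> x p = 0 \/ x p = 1).
  { intros x p x01 Hp h. rewrite in_fractional in h. specialize (x01 p).
    destruct (Req_EM_T (x p) 0); auto. destruct (Req_EM_T (x p) 1); auto.
    exfalso; apply h; split; auto; lra. }
  induction n as [|n IH]; intros x L x01;
    destruct (filter (fractional x) U) as [|p0 F0] eqn:EF; try (simpl in L; lia).
  1, 2: exists x; split; [|split; [auto|intros; lra]];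
    intros p Hp; apply edge; auto; now rewrite EF.
  rewrite <- EF in L.
  destruct (round_step BB U t NU Bal x x01) as (x' & x'01 & x'off & x'L & x'b); [now rewrite EF|].
  destruct (IH x') as (z & z1 & z2 & z3); auto; [lia|].
  assert (zx : forall p, In p U -> x p = 0 \/ x p = 1 -> z p = x p).
  { intros p Hp h. rewrite <- (x'off p); [apply z2; auto; rewrite (x'off p); auto|];
    intros H; apply in_fractional in H; lra. }
  exists z; split; [auto|split; [auto|]]. intros b Hb.
  destruct (Nat.lt_ge_cases t (length (filter (mem (filter (fractional x) U)) b))) as [h|h].
  - rewrite <- (x'b b Hb h). auto.
  - assert (E : rsum z b = rsum x b + rsum (fun p => z p - x p) b).
    { rewrite (rsum_ext (fun p => z p - x p) (fun p => z p + (-1) * x p)) by (intros; lra).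
      rewrite rsum_linear; lra. }
    rewrite E. clear E.
    rewrite <- (rsum_filter (fun p => z p - x p) (mem (filter (fractional x) U)) b).
    2:{ intros p Hp hp. rewrite (zx p); [lra|apply (IU b); auto|].
        apply edge; auto; [apply (IU b); auto|]. rewrite <- mem_spec. now rewrite hp. }
    set (D := filter (mem (filter (fractional x) U)) b) in *.
    destruct D as [|d D'] eqn:ED; [simpl; lra|]. rewrite <- ED in *.
    assert (sm : - INR (length D) < rsum (fun p => z p - x p) D < INR (length D)).
    { apply rsum_small; [|now rewrite ED]. intros p Hp. rewrite ED in Hp. unfold D in ED.
      rewrite <- ED in Hp. apply filter_In in Hp. destruct Hp as [pb pF].
      apply mem_spec, in_fractional in pF. destruct (z1 p) as [-> | ->]; try tauto; lra. }
    apply le_INR in h. rewrite ED in *. lra.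
Qed.

(** Rounding the constant vector [a] selects nearly the fraction [a] of all blocks
    simultaneously. *)
Lemma rounding_count BB t a : (forall b, In b BB -> NoDup b) -> balanced t BB -> (1 <= t)%nat ->
  0 <= a <= 1 -> exists c : point -> bool, forall b, In b BB ->
    a * INR (length b) - INR t < INR (length (filter c b)) < a * INR (length b) + INR t.
Proof.
  intros NB Bal ht ha.
  destruct (rounding BB (nodup point_eq_dec (concat BB)) t) with (x := fun _ : point => a)
    (n := length (filter (fractional (fun _ : point => a)) (nodup point_eq_dec (concat BB))))
    as (z & z1 & _ & z3); auto.
  - apply NoDup_nodup.
  - intros b Hb p Hp. apply nodup_In, in_concat. eauto.
  - exists (fun p => if Req_EM_T (z p) 1 then true else false). intros b Hb.
    specialize (z3 b Hb). rewrite rsum_const in z3.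
    assert (E : rsum z b = INR (length (filter (fun p => if Req_EM_T (z p) 1 then true else false) b))).
    { rewrite <- (rsum_filter z (fun p => if Req_EM_T (z p) 1 then true else false)).
      - rewrite (rsum_ext z (fun _ => 1)), rsum_const; [lra|].
        intros p Hp. apply filter_In in Hp. destruct (Req_EM_T (z p) 1); [auto|easy].
      - intros p Hp h. destruct (z1 p); auto.
        + apply nodup_In, in_concat. eauto.
        + now destruct (Req_EM_T (z p) 1). }
    lra.
Qed.

(** * Polychromatic colorings of blocks *)

Definition rainbow (BB : list (list point)) (k : nat) (col : point -> nat) : Prop :=
  forall b c, In b BB -> (c < k)%nat -> exists p, In p b /\ col p = c.

Lemma some_of_length (b : list point) : (1 <= length b)%nat -> exists p, In p b.
Proof. destruct b as [|p b]; simpl; [lia|]. exists p; auto. Qed.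

Lemma length_filter_negb (c : point -> bool) b :
  (length (filter c b) + length (filter (fun p => negb (c p)) b) = length b)%nat.
Proof. apply filter_length. Qed.

(** Rounding the constant [1 / (k + 1)] has target 1 and error below 1 in every block, so exactly
    one point per block gets the last color, and blocks of size [k] remain. *)
Lemma exact_rainbow k : forall BB, (forall b, In b BB -> NoDup b) -> balanced 1 BB ->
  (forall b, In b BB -> length b = k) -> exists col, rainbow BB k col.
Proof.
  induction k as [|k IH]; intros BB N Bal L.
  - exists (fun _ => 0%nat). intros b c _ Hc; lia.
  - assert (k0 : 0 < INR (S k)) by (apply lt_0_INR; lia).
    assert (k1 : 1 <= INR (S k)) by (apply (le_INR 1); lia).
    destruct (rounding_count BB 1 (/ INR (S k)) N Bal) as (x & Hx); auto.
    { split; [left; now apply Rinv_0_lt_compat|].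
      rewrite <- Rinv_1. apply Rinv_le_contravar; lra. }
    assert (one : forall b, In b BB -> length (filter x b) = 1%nat).
    { intros b Hb. specialize (Hx b Hb). rewrite (L b Hb) in Hx.
      replace (/ INR (S k) * INR (S k)) with 1 in Hx by (field; lra).
      simpl (INR 1) in Hx.
      assert (H1 : (0 < length (filter x b))%nat) by (apply INR_lt; simpl; lra).
      assert (H2 : (length (filter x b) < 2)%nat) by (apply INR_lt; simpl; lra).
      lia. }
    destruct (IH (map (filter (fun p => negb (x p))) BB)) as (col & Hcol).
    + intros b Hb. apply in_map_iff in Hb. destruct Hb as (b' & <- & Hb'). apply NoDup_filter; auto.
    + now apply balanced_sub.
    + intros b Hb. apply in_map_iff in Hb. destruct Hb as (b' & <- & Hb').
      assert (H := length_filter_negb x b'). rewrite (one b' Hb'), (L b' Hb') in H. lia.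
    + exists (fun p => if x p then k else col p). intros b c Hb Hc.
      destruct (Nat.eq_dec c k) as [->|h].
      * destruct (some_of_length (filter x b)) as (p & Hp); [rewrite one; auto|].
        apply filter_In in Hp. exists p. now rewrite (proj2 Hp).
      * destruct (Hcol (filter (fun p => negb (x p)) b) c) as (p & Hp & Ec); [now apply in_map|lia|].
        apply filter_In in Hp. destruct Hp as [Hp hx]. exists p. split; auto.
        now destruct (x p).
Qed.

(** The number 3 is the tolerance for three systems of disjoint blocks. Sizes are only bounded below
    because rounding with this tolerance does not produce classes of equal size. *)
Definition coverable (k s : nat) : Prop :=
  forall BB, (forall b, In b BB -> NoDup b) -> balanced 3 BB ->
  (forall b, In b BB -> (s <= length b)%nat) -> exists col, rainbow BB k col.

Lemma coverable_one : coverable 1 1.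
Proof.
  intros BB N _ L. exists (fun _ => 0%nat). intros b c Hb Hc.
  destruct (some_of_length b) as (p & Hp); auto. exists p; split; auto; lia.
Qed.

Lemma sign_change y b : rsum y b = 0 -> (exists p, In p b /\ y p <> 0) ->
  exists p q, In p b /\ In q b /\ 0 < y p /\ y q < 0.
Proof.
  intros H n. apply NNPP. intros no.
  assert (pos : forall L, (forall p, In p L -> 0 <= y p) -> rsum y L = 0 \/ 0 < rsum y L).
  { induction L as [|p L IH]; simpl; intros h; [auto|].
    assert (hp := h p (or_introl eq_refl)). destruct IH; auto; lra. }
  assert (all : forall L, (forall p, In p L -> 0 <= y p) -> rsum y L = 0 -> forall p, In p L -> y p = 0).
  { induction L as [|p L IH]; simpl; intros h e q Hq; [easy|].
    assert (hp := h p (or_introl eq_refl)).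
    destruct (pos L (fun z Hz => h z (or_intror Hz))) as [E|E]; [|lra].
    destruct Hq as [<-|Hq]; [lra|]. apply IH; auto. }
  destruct n as (p & Hp & yp).
  destruct (classic (exists q, In q b /\ y q < 0)) as [(q & Hq & yq)|n].
  - assert (neg : forall L, (forall p, In p L -> y p <= 0) -> (In q L -> rsum y L < 0) /\ rsum y L <= 0).
    { induction L as [|z L IH]; simpl; intros h; [split; [easy|lra]|].
      assert (hz := h z (or_introl eq_refl)). destruct IH as [I1 I2]; auto.
      split; [|lra]. intros [->|Hz]; [lra|]. specialize (I1 Hz); lra. }
    destruct (neg b) as [I1 _]; [|specialize (I1 Hq); lra].
    intros z Hz. destruct (Rle_dec (y z) 0); auto. exfalso; apply no.
    exists z, q; repeat split; auto; lra.
  - apply yp, (all b); auto. intros z Hz. destruct (Rle_dec 0 (y z)); auto.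
    exfalso; apply n; exists z; split; auto; lra.
Qed.

(* Seymour's argument: color the support of a kernel vector by signs, and recurse on its zeros. *)
Lemma coverable_two : coverable 2 4.
Proof.
  intros BB N Bal L.
  cut (forall n F, (length F <= n)%nat -> NoDup F ->
    exists col, rainbow (filter (fun b => forallb (mem F) b) BB) 2 col).
  { intros H. destruct (H _ (nodup point_eq_dec (concat BB)) (le_n _)) as (col & Hc).
    { apply NoDup_nodup. }
    exists col. intros b c Hb. apply Hc. apply filter_In. split; auto.
    apply forallb_forall. intros p Hp. apply mem_spec, nodup_In, in_concat. eauto. }
  induction n as [|n IH]; intros F LF NF.
  - exists (fun _ => 0%nat). intros b c Hb _. apply filter_In in Hb. destruct Hb as [Hb h].
    destruct F; [|simpl in LF; lia]. specialize (L b Hb).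
    destruct b as [|p b]; simpl in *; [lia|discriminate].
  - destruct F as [|p0 F0] eqn:EF; [apply (IH []); simpl; [lia|constructor]|]. rewrite <- EF in *.
    destruct (Bal F NF) as (y & (p & Hp & yp) & y2 & y3); [now rewrite EF|].
    set (G := filter (fun q => if Req_EM_T (y q) 0 then true else false) F).
    assert (NG : NoDup (p :: G)).
    { constructor; [|now apply NoDup_filter]. intros h. apply filter_In in h.
      now destruct (Req_EM_T (y p) 0). }
    assert (J : incl (p :: G) F) by (intros q [<-|h]; auto; apply filter_In in h; tauto).
    apply NoDup_incl_length in J; auto. simpl in J. inversion NG; subst.
    destruct (IH G) as (col & Hcol); [lia|auto|].
    exists (fun q => if Rlt_dec 0 (y q) then 0%nat else if Rlt_dec (y q) 0 then 1%nat else col q).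
    intros b c Hb Hc. apply filter_In in Hb. destruct Hb as [Hb h].
    rewrite forallb_forall in h.
    (* The size 4 enters here: a block inside [F] has more than 3 points in [F], so the move
       preserves its sum. *)
    assert (yb : rsum y b = 0).
    { apply y3; auto. rewrite forallb_filter_id.
      - specialize (L b Hb); lia.
      - now apply forallb_forall. }
    destruct (classic (exists q, In q b /\ y q <> 0)) as [e|e].
    + destruct (sign_change y b yb e) as (u & w & Hu & Hw & yu & yw).
      destruct c as [|[|c]]; [exists u|exists w|lia]; split; auto.
      * now destruct (Rlt_dec 0 (y u)).
      * destruct (Rlt_dec 0 (y w)); [lra|]. now destruct (Rlt_dec (y w) 0).
    + assert (z : forall q, In q b -> y q = 0).
      { intros q Hq. apply NNPP; intros ?; eauto. }
      destruct (Hcol b c) as (q & Hq & Ec); auto.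
      { apply filter_In; split; auto. apply forallb_forall. intros q Hq.
        apply mem_spec, filter_In. split; [now apply mem_spec, h|].
        rewrite (z q Hq). now destruct (Req_EM_T 0 0). }
      exists q; split; auto. rewrite (z q Hq).
      destruct (Rlt_dec 0 0); [lra|auto].
Qed.

(** Rounding errs by less than 3, so targets of [s1 + 2] and [s2 + 2] points leave more than
    [s1 - 1] and [s2 - 1], hence at least [s1] and [s2]. In larger blocks both targets grow by the
    factor [l / s]. *)
Lemma coverable_add k1 k2 s1 s2 :
  coverable k1 s1 -> coverable k2 s2 -> coverable (k1 + k2) (s1 + s2 + 4).
Proof.
  intros C1 C2 BB N Bal L.
  set (s := INR s1 + INR s2 + 4).
  assert (p1 := pos_INR s1). assert (p2 := pos_INR s2).
  assert (s0 : 0 < s) by (unfold s; lra).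
  destruct (rounding_count BB 3 ((INR s1 + 2) / s) N Bal) as (x & Hx); [lia| |].
  { split; [apply Rlt_le, Rdiv_lt_0_compat; lra|].
    apply Rmult_le_reg_r with s; auto. unfold Rdiv. rewrite Rmult_assoc, Rinv_l; unfold s in *; lra. }
  assert (big : forall b, In b BB -> (s1 <= length (filter x b))%nat /\
            (s2 <= length (filter (fun p => negb (x p)) b))%nat).
  { intros b Hb. specialize (Hx b Hb). specialize (L b Hb).
    assert (H := length_filter_negb x b). apply (f_equal INR) in H. rewrite plus_INR in H.
    apply le_INR in L. rewrite !plus_INR in L. simpl (INR 4) in L. simpl (INR 3) in Hx.
    set (l := INR (length b)) in *.
    assert (ls : 1 <= l / s).
    { apply Rmult_le_reg_r with s; auto. unfold Rdiv. rewrite Rmult_assoc, Rinv_l; unfold s in *; lra. }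
    assert (e1 : (INR s1 + 2) / s * l = (INR s1 + 2) * (l / s)) by (field; lra).
    assert (e2 : l = (INR s1 + 2) * (l / s) + (INR s2 + 2) * (l / s)) by (unfold s; field; fold s; lra).
    rewrite e1 in Hx.
    split; apply Nat.lt_succ_r, INR_lt; rewrite S_INR; nra. }
  destruct (C1 (map (filter x) BB)) as (c1 & H1).
  { intros b Hb. apply in_map_iff in Hb. destruct Hb as (b' & <- & Hb'). apply NoDup_filter; auto. }
  { now apply balanced_sub. }
  { intros b Hb. apply in_map_iff in Hb. destruct Hb as (b' & <- & Hb'). now apply big. }
  destruct (C2 (map (filter (fun p => negb (x p))) BB)) as (c2 & H2).
  { intros b Hb. apply in_map_iff in Hb. destruct Hb as (b' & <- & Hb'). apply NoDup_filter; auto. }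
  { now apply balanced_sub. }
  { intros b Hb. apply in_map_iff in Hb. destruct Hb as (b' & <- & Hb'). now apply big. }
  exists (fun p => if x p then c1 p else (k1 + c2 p)%nat). intros b c Hb Hc.
  destruct (Nat.lt_ge_cases c k1) as [h|h].
  - destruct (H1 (filter x b) c) as (p & Hp & Ec); auto; [now apply in_map|].
    apply filter_In in Hp. exists p. rewrite (proj2 Hp). tauto.
  - destruct (H2 (filter (fun p => negb (x p)) b) (c - k1)%nat) as (p & Hp & Ec);
      [now apply in_map|lia|].
    apply filter_In in Hp. destruct Hp as [Hp xp]. exists p. split; auto.
    destruct (x p); [easy|lia].
Qed.

Lemma coverable_le k s s' : (s <= s')%nat -> coverable k s -> coverable k s'.
Proof. intros H C BB N Bal L. apply C; auto. intros b Hb. specialize (L b Hb); lia. Qed.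

(** Adding single colors would cost [1 + 4] points each; pairs of colors cost [4 + 4], which is 4
    per color. Steps of two require both parities as start. *)
Lemma coverable_linear k : (1 <= k)%nat -> coverable k (4 * k - 3).
Proof.
  intros K. cut (coverable k (4 * k - 3) /\ coverable (S k) (4 * S k - 3)); [tauto|].
  induction k as [|k IH]; [lia|]. destruct k as [|k].
  - split; [exact coverable_one|]. apply (coverable_le 2 4); [lia|exact coverable_two].
  - destruct IH as [H1 H2]; [lia|]. split; auto.
    replace (S (S (S k))) with (S k + 2)%nat by lia.
    replace (4 * (S k + 2) - 3)%nat with ((4 * S k - 3) + 4 + 4)%nat by lia.
    apply coverable_add; [auto|exact coverable_two].
Qed.

(** * Strips *)

Definition strip (f : point -> R) (a b : R) : range := fun p => a <= f p <= b.

Lemma rich_low f V A B s b : NoDup V -> Permutation V (A ++ B) -> length A = s ->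
  (forall x y, In x A -> In y B -> f x < f y) ->
  rich V (fun p => f p <= b) s -> forall p, In p A -> f p <= b.
Proof.
  intros N PV LA AB (E & NE & IE & RE & LE) p Hp.
  destruct (Rle_dec (f p) b) as [|h]; auto. exfalso.
  assert (J : incl (p :: E) A).
  { intros e [<-|He]; auto. specialize (RE e He). cbv beta in RE.
    assert (H := Permutation_in e PV (IE e He)). apply in_app_iff in H.
    destruct H as [|H]; auto. specialize (AB p e Hp H); lra. }
  apply NoDup_incl_length in J; [simpl in J; lia|].
  constructor; [|exact NE]. intros He. apply RE in He; lra.
Qed.

(** The blocks are runs of [s] consecutive points, with fewer than [s] points left over at the upper
    end. The clause on half-lines serves the induction: a strip meeting the first block without
    containing it has at least [s] points beyond that block, where its lower bound is automatic. *)
Lemma blocks_exist f s : (1 <= s)%nat -> forall n V, (length V <= n)%nat -> NoDup V ->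
  inj_on f V -> exists BB, NoDup (concat BB) /\
    (forall b, In b BB -> NoDup b /\ incl b V /\ length b = s) /\
    (forall a b, rich V (strip f a b) (2 * s - 1) -> exists B, In B BB /\ forall p, In p B -> strip f a b p) /\
    (forall b, rich V (fun p => f p <= b) s -> exists B, In B BB /\ forall p, In p B -> f p <= b).
Proof.
  intros hs.
  assert (few : forall V (r : range) m, (length V < s)%nat -> (s <= m)%nat -> ~ rich V r m).
  { intros V r m hV hm (E & NE & IE & RE & LE). apply NoDup_incl_length in IE; auto; lia. }
  induction n as [|n IH]; intros V LV N I;
    destruct (Nat.lt_ge_cases (length V) s) as [h|h]; try lia.
  1, 2: exists []; split; [constructor|split; [easy|]];
    split; intros; exfalso; eapply few; try eassumption; lia.
  destruct (split_low f V s N I h) as (A & B & PV & LA & AB).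
  assert (NAB : NoDup (A ++ B)) by (eapply Permutation_NoDup; eauto).
  destruct (NoDup_app_inv _ _ NAB) as (NA & NB & disj).
  assert (inV : forall p, In p V <-> In p A \/ In p B).
  { intros p. rewrite <- in_app_iff. split; apply Permutation_in; auto. now symmetry. }
  destruct (IH B) as (BB & B1 & B2 & B3 & B4); auto.
  { apply Permutation_length in PV. rewrite length_app in PV. lia. }
  { eapply inj_on_incl; [|exact I]. intros p Hp; apply inV; auto. }
  exists (A :: BB). split; [|split; [|split]].
  - simpl. apply NoDup_app; auto. intros p Hp H. apply (disj p Hp).
    apply in_concat in H. destruct H as (b & Hb & H). now apply (B2 b Hb).
  - intros b [<-|Hb].
    + split; [auto|split; [|auto]]. intros p Hp; apply inV; auto.
    + destruct (B2 b Hb) as (b1 & b2 & b3). split; [auto|split; [|auto]].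
      intros p Hp; apply inV; auto.
  - intros a b HE.
    destruct (classic (forall p, In p A -> strip f a b p)) as [all|n0].
    { exists A; split; [now left|auto]. }
    destruct HE as (E & NE & IE & RE & LE).
    assert (NP : exists z, In z A /\ ~ In z E).
    { apply not_all_ex_not in n0. destruct n0 as (z & Hz). apply imply_to_and in Hz.
      exists z; split; [tauto|]. intros H; apply RE in H; tauto. }
    destruct NP as (z & zA & zE).
    assert (LL := length_minus E A).
    assert (RB : forall m, (m <= length (minus E A))%nat -> forall r : range,
              (forall p, In p E -> r p) -> rich B r m).
    { intros m Hm r Hr. exists (minus E A). split; [now apply NoDup_minus|].
      split; [|split; auto].
      - intros p Hp. apply in_minus in Hp. destruct Hp as [pE pA].
        destruct (proj1 (inV p) (IE p pE)); easy.
      - intros p Hp. apply in_minus in Hp. apply Hr; tauto. }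
    destruct (classic (exists e, In e E /\ In e A)) as [(e & eE & eA)|n1].
    + assert (LF : (S (length (filter (mem A) E)) <= length A)%nat).
      { apply (NoDup_incl_length (l := z :: filter (mem A) E)).
        - constructor; [|now apply NoDup_filter]. intros H; apply filter_In in H; tauto.
        - intros p [<-|Hp]; auto. apply filter_In in Hp. rewrite mem_spec in Hp; tauto. }
      destruct (B4 b) as (b0 & Hb0 & Hb).
      { apply RB; [lia|]. intros p Hp; apply RE in Hp. unfold strip in Hp. lra. }
      exists b0; split; [now right|]. intros p Hp. split; auto.
      destruct (B2 b0 Hb0) as (_ & ib & _).
      specialize (AB e p eA (ib p Hp)). apply RE in eE. unfold strip in eE. lra.
    + destruct (B3 a b) as (b0 & Hb0 & Hb).
      { apply RB; auto. assert (filter (mem A) E = []) as E0; [|rewrite E0 in LL; simpl in LL; lia].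
        destruct (filter (mem A) E) as [|e l] eqn:EE; auto. exfalso; apply n1.
        assert (H : In e (filter (mem A) E)) by (rewrite EE; now left).
        apply filter_In in H. rewrite mem_spec in H. eauto. }
      exists b0; split; [now right|auto].
  - intros b HE. exists A; split; [now left|]. now apply (rich_low f V A B s b).
Qed.

Lemma rainbow_strip f V BB s k col a b :
  (forall B, In B BB -> NoDup B /\ incl B V /\ length B = s) ->
  (forall a b, rich V (strip f a b) (2 * s - 1) ->
     exists B, In B BB /\ forall p, In p B -> strip f a b p) ->
  rainbow BB k col -> rich V (strip f a b) (2 * s - 1) -> hits_all V V (strip f a b) col k.
Proof.
  intros B2 B3 HR HE c Hc. destruct (B3 a b HE) as (B & HB & rB).
  destruct (HR B c HB Hc) as (p & Hp & Ec). exists p; split; auto. now apply (B2 B).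
Qed.

Lemma two_strips_coloring f g V k : NoDup V -> inj_on f V -> inj_on g V -> (1 <= k)%nat ->
  exists col, forall a b,
    (rich V (strip f a b) (2 * k - 1) -> hits_all V V (strip f a b) col k) /\
    (rich V (strip g a b) (2 * k - 1) -> hits_all V V (strip g a b) col k).
Proof.
  intros N If Ig K.
  destruct (blocks_exist f k K _ V (le_n _) N If) as (B1 & N1 & P1 & S1 & _).
  destruct (blocks_exist g k K _ V (le_n _) N Ig) as (B2 & N2 & P2 & S2 & _).
  assert (P : forall b, In b (B1 ++ B2) -> NoDup b /\ incl b V /\ length b = k).
  { intros b Hb. apply in_app_iff in Hb. destruct Hb; auto. }
  destruct (exact_rainbow k (B1 ++ B2)) as (col & H).
  - intros b Hb. now apply P.
  - apply balanced_two; auto. intros b Hb; now apply P.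
  - intros b Hb. now apply P.
  - exists col. intros a b. split; intros HE;
    [apply (rainbow_strip f V B1 k)|apply (rainbow_strip g V B2 k)]; auto;
    intros B c HB; apply H, in_app_iff; auto.
Qed.

Lemma three_strips_coloring f g h V k s : NoDup V -> inj_on f V -> inj_on g V -> inj_on h V ->
  (1 <= s)%nat -> coverable k s ->
  exists col, forall a b,
    (rich V (strip f a b) (2 * s - 1) -> hits_all V V (strip f a b) col k) /\
    (rich V (strip g a b) (2 * s - 1) -> hits_all V V (strip g a b) col k) /\
    (rich V (strip h a b) (2 * s - 1) -> hits_all V V (strip h a b) col k).
Proof.
  intros N If Ig Ih hs C.
  destruct (blocks_exist f s hs _ V (le_n _) N If) as (B1 & N1 & P1 & S1 & _).
  destruct (blocks_exist g s hs _ V (le_n _) N Ig) as (B2 & N2 & P2 & S2 & _).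
  destruct (blocks_exist h s hs _ V (le_n _) N Ih) as (B3 & N3 & P3 & S3 & _).
  assert (P : forall b, In b (B1 ++ B2 ++ B3) -> NoDup b /\ incl b V /\ length b = s).
  { intros b Hb. rewrite !in_app_iff in Hb. destruct Hb as [|[|]]; auto. }
  destruct (C (B1 ++ B2 ++ B3)) as (col & H).
  - intros b Hb. now apply P.
  - apply balanced_three; auto. intros b Hb; now apply P.
  - intros b Hb. destruct (P b Hb) as (_ & _ & ->); auto.
  - exists col. intros a b. split; [|split]; intros HE;
    [apply (rainbow_strip f V B1 s)|apply (rainbow_strip g V B2 s)|apply (rainbow_strip h V B3 s)];
    auto; intros B c HB; apply H; rewrite !in_app_iff; auto.
Qed.

(** * Combining the colorings *)

Definition is_quadrant (f g : point -> R) : Defs.family := fun r =>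
  exists a b, forall p, r p <-> quadrant f g a b p.

Definition colorable (V : list point) (F : Defs.family) (m k : nat) : Prop :=
  exists col, forall r, F r -> rich V r m -> hits_all V V r col k.

Lemma rich_ext V r r' n : (forall p, r p <-> r' p) -> rich V r n -> rich V r' n.
Proof.
  intros H (E & NE & IE & RE & LE). exists E. split; [auto|split; [auto|split; [|auto]]].
  intros p Hp; apply H; auto.
Qed.

Lemma hits_all_ext V X r r' col k : (forall p, r p <-> r' p) ->
  hits_all V X r col k -> hits_all V X r' col k.
Proof.
  intros H HA c Hc. destruct (HA c Hc) as (p & p1 & p2 & p3). exists p; split; [auto|split; [|auto]].
  now apply H.
Qed.

(** The points of [X] serve the quadrants, all others serve [F], and [e] is the price that [F] pays.
    The last premise ranges over all subsets so that families can be added repeatedly. *)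
Lemma add_quadrant f g F V k m e : NoDup V -> inj_on f V -> inj_on g V -> (k <= m)%nat ->
  (forall X col, (forall p, In p X -> (col p < k)%nat) ->
     (forall p, In p X -> guarded f g V X col (m - k) (fun _ => False) p) ->
     forall r, F r -> rich V r m -> rich (minus V X) r (m - e)) ->
  (forall V', NoDup V' -> incl V' V -> colorable V' F (m - e) k) ->
  colorable V (funion (is_quadrant f g) F) m k.
Proof.
  intros N If Ig K cost rest.
  destruct (quadrant_coloring f g V m k) as (X & c1 & X1 & X2 & X3 & X4); auto.
  assert (IM : incl (minus V X) V) by (intros p Hp; apply in_minus in Hp; tauto).
  destruct (rest (minus V X)) as (c2 & H2); auto.
  { now apply NoDup_minus. }
  exists (fun p => if mem X p then c1 p else c2 p). intros r [(a & b & Hr)|Fr] HE c Hc.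
  - destruct (X4 a b) with (c := c) as (p & p1 & p2 & p3); auto.
    { eapply rich_ext; eauto. }
    exists p. split; [auto|split; [now apply Hr|]].
    apply mem_spec in p1. now rewrite p1.
  - destruct (H2 r Fr (cost X c1 X2 X3 r Fr HE) c Hc) as (p & p1 & p2 & p3).
    exists p. split; [auto|split; [auto|]]. apply in_minus in p1.
    destruct (mem X p) eqn:E; auto. apply mem_spec in E; tauto.
Qed.

Lemma colorable_sub V (F F' : Defs.family) m k : (forall r, F r -> F' r) ->
  colorable V F' m k -> colorable V F m k.
Proof. intros H (col & Hc). exists col; auto. Qed.

Lemma good_of_colorable F k m : (1 <= k)%nat ->
  (forall V, NoDup V -> inj_on fst V -> inj_on snd V -> inj_on (fun p => fst p + snd p) V ->
     colorable V F m k) -> good F k m.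
Proof.
  intros K H V (N & N1 & N2 & N3).
  destruct (H V) as (col & Hcol); auto using inj_on_map.
  (* Points left uncolored may carry values outside the palette; 0 is a color because [1 <= k]. *)
  exists (fun p => if col p <? k then col p else 0)%nat. split.
  - intros p _. destruct (col p <? k)%nat eqn:E; [now apply Nat.ltb_lt|lia].
  - intros E (NE & LE & r & Fr & HE) c Hc.
    destruct (Hcol r Fr) with (c := c) as (p & p1 & p2 & p3); auto.
    { exists E. split; [auto|split; [|split; [|lia]]]; intros p Hp; apply HE in Hp; tauto. }
    exists p. split; [apply HE; auto|]. rewrite p3.
    apply Nat.ltb_lt in Hc. now rewrite Hc.
Qed.

(** The weak convexity that [cost_two] uses for NW and SE. Diagonal strips have it since [x + y] is
    monotone in both coordinates; the antidiagonal version fails for them in general. *)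
Definition diagonal_closed (r : range) : Prop := forall p q u, r p -> r q ->
  fst p <= fst u <= fst q -> snd p <= snd u <= snd q -> r u.

Definition antidiagonal_closed (r : range) : Prop := forall p q u, r p -> r q ->
  fst p <= fst u <= fst q -> snd q <= snd u <= snd p -> r u.

Lemma bottomless_quadrants_colorable V k : (1 <= k)%nat -> NoDup V -> inj_on fst V ->
  inj_on snd V -> colorable V (funion R_BL (funion R_NW R_NE)) (5 * k - 2) k.
Proof.
  intros K N Ix Iy.
  apply colorable_sub with
    (funion (is_quadrant fst snd) (funion (is_quadrant (fun p => - fst p) snd) R_BL)).
  { intros r [H|[(a & b & H)|(a & b & H)]]; unfold funion; auto.
    - left. exists a, b. intros p; rewrite H; unfold quadrant; split; lra.
    - right; left. exists (- a), b. intros p; rewrite H; unfold quadrant; split; lra. }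
  apply add_quadrant with (e := k); auto; [lia| |].
  { intros X col HX G r Fr. apply (cost_one fst snd V X col k); auto.
    intros p q pr qr hpq.
    destruct Fr as [(a & b & H)|(a1 & a2 & b & H)];
      unfold quadrant in *; rewrite H in pr, qr; [left|right]; intros; apply H; lra. }
  intros V' N' I'. apply add_quadrant with (e := k); auto; [|eauto using inj_on_incl|lia| |].
  { apply inj_on_opp; eauto using inj_on_incl. }
  { intros X col HX G r (a1 & a2 & b & H).
    apply (cost_one (fun p => - fst p) snd V' X col k); auto.
    { apply inj_on_opp; eauto using inj_on_incl. }
    intros p q pr qr hpq. rewrite H in pr, qr. right; intros; apply H; lra. }
  intros V'' N'' I''.
  destruct (bottomless_coloring fst snd V'' k) as (col & Hcol);
    eauto using inj_on_incl.
  exists col. intros r (a1 & a2 & b & H) HE.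
  apply (hits_all_ext V'' V'' (fun p => a1 <= fst p /\ fst p <= a2 /\ snd p <= b)).
  { intros p; now rewrite H. }
  apply Hcol. apply rich_ext with r; auto. eapply rich_le; [|exact HE]. lia.
Qed.

Lemma strip_family f V m k col r : (forall a b, rich V (strip f a b) m -> hits_all V V (strip f a b) col k) ->
  (exists a b, forall p, r p <-> (a <= f p /\ f p <= b)) ->
  rich V r m -> hits_all V V r col k.
Proof.
  intros H (a & b & Hr) HE. apply (hits_all_ext V V (strip f a b)).
  { intros p; rewrite Hr; unfold strip; tauto. }
  apply H. eapply rich_ext; [|exact HE]. intros p; rewrite Hr; unfold strip; tauto.
Qed.

(** NW and SE are exchanged by negating both coordinates; this preserves the diagonal direction and
    only swaps the two corners of a box. *)
Lemma add_diagonal_quadrant f g F V k m : NoDup V -> inj_on fst V -> inj_on snd V ->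
  (f = fst /\ g = snd \/ f = (fun p => - fst p) /\ g = (fun p => - snd p)) ->
  (2 * k <= m)%nat -> (forall r, F r -> diagonal_closed r) ->
  (forall V', NoDup V' -> incl V' V -> colorable V' F (m - 2 * k) k) ->
  colorable V (funion (is_quadrant f g) F) m k.
Proof.
  intros N Ix Iy E K D rest.
  assert (If : inj_on f V) by (destruct E as [[-> ->]|[-> ->]]; auto using inj_on_opp).
  assert (Ig : inj_on g V) by (destruct E as [[-> ->]|[-> ->]]; auto using inj_on_opp).
  apply add_quadrant with (e := (2 * k)%nat); auto; [lia|].
  intros X col HX G r Fr. apply (cost_two f g V X col k); auto.
  intros p q u pr qr h1 h2 h3 h4.
  destruct E as [[-> ->]|[-> ->]]; [apply (D r Fr p q)|apply (D r Fr q p)]; auto; lra.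
Qed.

Lemma add_antidiagonal_quadrant f g F V k m : NoDup V -> inj_on fst V -> inj_on snd V ->
  (f = (fun p => - fst p) /\ g = snd \/ f = fst /\ g = (fun p => - snd p)) ->
  (2 * k <= m)%nat -> (forall r, F r -> antidiagonal_closed r) ->
  (forall V', NoDup V' -> incl V' V -> colorable V' F (m - 2 * k) k) ->
  colorable V (funion (is_quadrant f g) F) m k.
Proof.
  intros N Ix Iy E K D rest.
  assert (If : inj_on f V) by (destruct E as [[-> ->]|[-> ->]]; auto using inj_on_opp).
  assert (Ig : inj_on g V) by (destruct E as [[-> ->]|[-> ->]]; auto using inj_on_opp).
  apply add_quadrant with (e := (2 * k)%nat); auto; [lia|].
  intros X col HX G r Fr. apply (cost_two f g V X col k); auto.
  intros p q u pr qr h1 h2 h3 h4.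
  destruct E as [[-> ->]|[-> ->]]; [apply (D r Fr q p)|apply (D r Fr p q)]; auto; lra.
Qed.

(** Quadrant families still to be treated are among the ranges that must keep enough points. Like
    the strips they are axis-parallel and hence closed in both directions. *)
Lemma strips_quadrants_colorable V k : (1 <= k)%nat -> NoDup V -> inj_on fst V -> inj_on snd V ->
  colorable V (funion R_HS (funion R_VS (funion R_NW (funion R_NE (funion R_SW R_SE)))))
    (10 * k - 1) k.
Proof.
  intros K N Ix Iy.
  apply colorable_sub with
    (funion (is_quadrant fst snd) (funion (is_quadrant (fun p => - fst p) (fun p => - snd p))
    (funion (is_quadrant (fun p => - fst p) snd) (funion (is_quadrant fst (fun p => - snd p))
    (funion R_HS R_VS))))).
  { intros r [H|[H|[(a & b & H)|[(a & b & H)|[(a & b & H)|(a & b & H)]]]]]; unfold funion; auto 10.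
    - left. exists a, b. intros p; rewrite H; unfold quadrant; split; lra.
    - right; right; left. exists (- a), b. intros p; rewrite H; unfold quadrant; split; lra.
    - right; right; right; left. exists a, (- b). intros p; rewrite H; unfold quadrant; split; lra.
    - right; left. exists (- a), (- b). intros p; rewrite H; unfold quadrant; split; lra. }
  assert (solve_closed : forall r, funion (is_quadrant (fun p => - fst p) (fun p => - snd p))
    (funion (is_quadrant (fun p => - fst p) snd) (funion (is_quadrant fst (fun p => - snd p))
    (funion R_HS R_VS))) r -> diagonal_closed r /\ antidiagonal_closed r).
  { intros r [(a & b & H)|[(a & b & H)|[(a & b & H)|[(a & b & H)|(a & b & H)]]]];
    (split; intros p q u pr qr h1 h2; unfold quadrant in *; rewrite H in *; lra). }
  apply add_diagonal_quadrant; auto; [lia|intros r Fr; now apply solve_closed|].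
  intros V1 N1 I1. assert (Ix1 := inj_on_incl _ _ _ I1 Ix). assert (Iy1 := inj_on_incl _ _ _ I1 Iy).
  apply add_diagonal_quadrant; auto; [lia|intros r Fr; apply solve_closed; now right|].
  intros V2 N2 I2. assert (Ix2 := inj_on_incl _ _ _ I2 Ix1). assert (Iy2 := inj_on_incl _ _ _ I2 Iy1).
  apply add_antidiagonal_quadrant; auto; [lia|intros r Fr; apply solve_closed; now right; right|].
  intros V3 N3 I3. assert (Ix3 := inj_on_incl _ _ _ I3 Ix2). assert (Iy3 := inj_on_incl _ _ _ I3 Iy2).
  apply add_antidiagonal_quadrant; auto; [lia|intros r Fr; apply solve_closed; now right; right; right|].
  intros V4 N4 I4. assert (Ix4 := inj_on_incl _ _ _ I4 Ix3). assert (Iy4 := inj_on_incl _ _ _ I4 Iy3).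
  destruct (two_strips_coloring fst snd V4 k) as (col & H); auto.
  replace (10 * k - 1 - 2 * k - 2 * k - 2 * k - 2 * k)%nat with (2 * k - 1)%nat by lia.
  exists col. intros r [Fr|Fr].
  - apply (strip_family snd); auto. intros a b; apply H.
  - apply (strip_family fst); auto. intros a b; apply H.
Qed.

(** The block size stays a parameter because [k = 2] needs its own value, and [m] is only bounded
    below because the final bound is a ceiling. *)
Lemma diagonal_strips_colorable V k s m : coverable k s -> (1 <= s)%nat ->
  (2 * s - 1 + 4 * k <= m)%nat -> NoDup V -> inj_on fst V -> inj_on snd V ->
  inj_on (fun p => fst p + snd p) V ->
  colorable V (funion R_HS (funion R_VS (funion R_DS (funion R_NW R_SE)))) m k.
Proof.
  intros C hs Hm N Ix Iy Id.
  apply colorable_sub with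
    (funion (is_quadrant fst snd) (funion (is_quadrant (fun p => - fst p) (fun p => - snd p))
    (funion R_HS (funion R_VS R_DS)))).
  { intros r [H|[H|[H|[(a & b & H)|(a & b & H)]]]]; unfold funion; auto 10.
    - left. exists a, b. intros p; rewrite H; unfold quadrant; split; lra.
    - right; left. exists (- a), (- b). intros p; rewrite H; unfold quadrant; split; lra. }
  assert (solve_closed : forall r, funion (is_quadrant (fun p => - fst p) (fun p => - snd p))
    (funion R_HS (funion R_VS R_DS)) r -> diagonal_closed r).
  { intros r [(a & b & H)|[(a & b & H)|[(a & b & H)|(a & b & H)]]];
    intros p q u pr qr h1 h2; unfold quadrant in *; rewrite H in *; lra. }
  apply add_diagonal_quadrant; auto; [lia|].
  intros V1 N1 I1. assert (Ix1 := inj_on_incl _ _ _ I1 Ix). assert (Iy1 := inj_on_incl _ _ _ I1 Iy).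
  apply add_diagonal_quadrant; auto; [lia|intros r Fr; apply solve_closed; now right|].
  intros V2 N2 I2. assert (Ix2 := inj_on_incl _ _ _ I2 Ix1). assert (Iy2 := inj_on_incl _ _ _ I2 Iy1).
  assert (Id2 := inj_on_incl _ _ _ I2 (inj_on_incl _ _ _ I1 Id)).
  destruct (three_strips_coloring fst snd (fun p => fst p + snd p) V2 k s) as (col & H); auto.
  exists col. intros r Fr HE.
  assert (HE' : rich V2 r (2 * s - 1)) by (eapply rich_le; [|exact HE]; lia).
  destruct Fr as [Fr|[Fr|Fr]].
  - apply (strip_family snd V2 (2 * s - 1)); auto. intros a b; apply H.
  - apply (strip_family fst V2 (2 * s - 1)); auto. intros a b; apply H.
  - apply (strip_family (fun p => fst p + snd p) V2 (2 * s - 1)); auto. intros a b; apply H.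
Qed.

(** * The numerical bound *)

(** The 32nd power of [1 - 1 / 32 <= exp (- (1 / 32))]. The bound has to stay below [3 ^ (15 / 16)],
    about 2.80, to give the estimate of [ln 3]. *)
Lemma exp_1_lt : exp 1 < 2.77.
Proof.
  assert (H : 31 / 32 <= exp (- (1 / 32))).
  { eapply Rle_trans; [|apply exp_ineq1_le]. lra. }
  assert (E : exp (- (1 / 32)) ^ 32 * exp 1 = 1).
  { assert (W : forall n, exp (- (1 / 32)) ^ n = exp (INR n * - (1 / 32))).
    { induction n as [|n IH]; [now rewrite Rmult_0_l, exp_0|].
      rewrite S_INR, <- tech_pow_Rmult, IH, <- exp_plus. f_equal; lra. }
    rewrite W, <- exp_plus.
    replace (INR 32 * - (1 / 32) + 1) with 0 by (simpl; lra). apply exp_0. }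
  assert (P : (31 / 32) ^ 32 <= exp (- (1 / 32)) ^ 32) by (apply pow_incr; lra).
  assert (Q : 1 / 2.77 < (31 / 32) ^ 32) by lra.
  assert (0 < exp 1) by apply exp_pos.
  nra.
Qed.

Lemma ln_gt x n d : 0 < x -> (0 < d)%nat -> (exp 1) ^ n < x ^ d -> INR n / INR d < ln x.
Proof.
  intros Hx Hd H. assert (d0 : 0 < INR d) by now apply lt_0_INR.
  apply ln_increasing in H; [|apply pow_lt, exp_pos].
  rewrite !ln_pow, ln_exp in H by (auto; apply exp_pos).
  apply Rmult_lt_reg_l with (INR d); auto.
  replace (INR d * (INR n / INR d)) with (INR n) by (field; lra). lra.
Qed.

(** Exactly what [k = 3] demands: blocks of size 9 require [15 * ln 3] to exceed 16. *)
Lemma ln_3_gt : 16 / 15 < ln 3.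
Proof.
  replace (16 / 15) with (INR 16 / INR 15) by (simpl; lra).
  apply ln_gt; [lra|lia|].
  apply Rle_lt_trans with (2.77 ^ 16); [|lra].
  apply pow_incr. split; [left; apply exp_pos|left; apply exp_1_lt].
Qed.

(** Exactly what [k = 5] demands once [ln 5] is replaced by [2 * ln 2]: then [40 * ln 2 + 5 * ln 3]
    must exceed 32. *)
Lemma ln_2_gt : 2 / 3 < ln 2.
Proof.
  replace (2 / 3) with (INR 2 / INR 3) by (simpl; lra).
  apply ln_gt; [lra|lia|].
  apply Rle_lt_trans with (2.77 ^ 2); [|lra].
  apply pow_incr. split; [left; apply exp_pos|left; apply exp_1_lt].
Qed.

Lemma ceilZ_gt x n : IZR n < x -> (n < ceilZ x)%Z.
Proof.
  intros H. unfold ceilZ. destruct (archimed (- x)) as [_ h].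
  assert (IZR (up (- x)) < IZR (1 - n)) by (rewrite minus_IZR; lra).
  apply lt_IZR in H0. lia.
Qed.

Lemma block_bound k : (1 <= k)%nat -> exists s, (1 <= s)%nat /\ coverable k s /\
  (2 * Z.of_nat s - 1 <= ceilZ (4 * INR k * ln (INR k) + INR k * ln 3))%Z.
Proof.
  intros K. assert (l2 := ln_2_gt). assert (l3 := ln_3_gt).
  (* A strict bound by [2 * s - 2] suffices, since the ceiling is an integer. *)
  cut (exists s, (1 <= s)%nat /\ coverable k s /\
    2 * INR s - 2 < 4 * INR k * ln (INR k) + INR k * ln 3).
  { intros (s & hs & C & H). exists s. split; [auto|split; [auto|]].
    assert (2 * Z.of_nat s - 2 < ceilZ (4 * INR k * ln (INR k) + INR k * ln 3))%Z; [|lia].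
    apply ceilZ_gt. rewrite minus_IZR, mult_IZR, <- INR_IZR_INZ. auto. }
  (* For [k = 2], blocks of size [4 k - 3 = 5] would exceed the bound. *)
  destruct (Nat.eq_dec k 2) as [->|k2].
  { exists 4%nat. split; [lia|split; [exact coverable_two|]]. simpl INR.
    replace (1 + 1) with 2 by lra. lra. }
  exists (4 * k - 3)%nat. split; [lia|split; [now apply coverable_linear|]].
  rewrite minus_INR, mult_INR by lia. simpl (INR 4). simpl (INR 3).
  assert (mono : forall n, (1 <= n)%nat -> (n <= k)%nat -> ln (INR n) <= ln (INR k)).
  { intros n hn h. apply le_INR in h. apply (le_INR 1) in hn. simpl in hn.
    destruct (Req_dec (INR n) (INR k)) as [->|ne]; [lra|]. left; apply ln_increasing; lra. }
  assert (l4 : ln 4 = 2 * ln 2) by (replace 4 with (2 * 2) by lra; rewrite ln_mult; lra).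
  assert (l6 : ln 6 = ln 2 + ln 3) by (replace 6 with (2 * 3) by lra; rewrite ln_mult; lra).
  assert (cases : k = 1%nat \/ k = 3%nat \/ k = 4%nat \/ k = 5%nat \/ (6 <= k)%nat) by lia.
  destruct cases as [->|[->|[->|[->|h]]]].
  - simpl INR. rewrite ln_1. lra.
  - replace (INR 3) with 3 by (simpl; lra). lra.
  - replace (INR 4) with 4 by (simpl; lra). lra.
  - assert (M := mono 4%nat). replace (INR 4) with 4 in M by (simpl; lra).
    specialize (M ltac:(lia) ltac:(lia)).
    replace (INR 5) with 5 in * by (simpl; lra). nra.
  (* From 6 on, [4 * ln 6 + ln 3] exceeds [4 * (2 / 3 + 16 / 15) + 16 / 15 = 8], so the bound beats
     [8 * k]. *)
  - assert (M := mono 6%nat ltac:(lia) h). replace (INR 6) with 6 in M by (simpl; lra).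
    assert (h' := le_INR _ _ h). replace (INR 6) with 6 in h' by (simpl; lra). nra.
Qed.

Theorem theorem17 :
  (forall k : nat, (1 <= k)%nat ->
     mR_le (funion R_BL (funion R_NW R_NE)) k (5 * k - 2)) /\
  (forall k : nat, (1 <= k)%nat ->
     mR_le (funion R_HS (funion R_VS (funion R_NW (funion R_NE (funion R_SW R_SE)))))
           k (10 * k - 1)) /\
  (forall k : nat, (1 <= k)%nat ->
     exists M : nat,
       Z.of_nat M = (ceilZ (4 * INR k * ln (INR k) + INR k * ln 3) + 4 * Z.of_nat k)%Z /\
       mR_le (funion R_HS (funion R_VS (funion R_DS (funion R_NW R_SE)))) k M).
Proof.
  split; [|split]; intros k K.
  - exists (5 * k - 2)%nat. split; [lia|]. apply good_of_colorable; auto.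
    intros V N Ix Iy _. now apply bottomless_quadrants_colorable.
  - exists (10 * k - 1)%nat. split; [lia|]. apply good_of_colorable; auto.
    intros V N Ix Iy _. now apply strips_quadrants_colorable.
  - destruct (block_bound k K) as (s & hs & C & B).
    set (z := ceilZ (4 * INR k * ln (INR k) + INR k * ln 3)) in *.
    (* By [B] the integer [z] is at least [2 * s - 1], hence positive, and nothing is lost in
       passing to [nat]. *)
    exists (Z.to_nat (z + 4 * Z.of_nat k)). split; [lia|].
    exists (Z.to_nat (z + 4 * Z.of_nat k)). split; [lia|].
    apply good_of_colorable; auto.
    intros V N Ix Iy Id. apply (diagonal_strips_colorable V k s); auto. lia.
Qed.
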